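(* Let $q=\sigma'+\tau$ be a singular Gordon potential. Then the Schrödinger operator $S=-\frac{d^2}{dt^2}+q$ in $L_2(\mathbb{R})$ has no eigenvalues; that is, there are no $\lambda\in\mathbb{C}$ and nonzero $u\in\mathfrak{D}(S)$ with $Su=\lambda u$.
   Context: Function spaces: $L_{2,unif}(\mathbb{R})$ is the space of measurable functions $\sigma$ with $\|\sigma\|_{2,unif}^2:=\sup_{t\in\mathbb{R}}\int_t^{t+1}|\sigma(s)|^2\,ds<\infty$, and $L_{1,unif}(\mathbb{R})$ the space of measurable functions $\tau$ with $\|\tau\|_{1,unif}:=\sup_{t\in\mathbb{R}}\int_t^{t+1}|\tau(s)|\,ds<\infty$. $W^1_2(\mathbb{R})$ is the usual ($L_2$-based, complex-valued) Sobolev space, and $W^1_{1,loc}(\mathbb{R})$ is the space of locally absolutely continuous functions. Potentials: $W^{-1}_2(\mathbb{R})$ denotes the dual of $W^1_2(\mathbb{R})$. Let $\phi(t)=2(t+1)^2$ on $[-1,-1/2)$, $\phi(t)=1-2t^2$ on $[-1/2,1/2)$, $\phi(t)=2(t-1)^2$ on $[1/2,1]$, $\phi(t)=0$ otherwise, and $\phi_n(t)=\phi(t-n)$, $n\in\mathbb{Z}$. A distribution $f$ belongs to $W^{-1}_{2,unif}(\mathbb{R})$ if $f\phi_n\in W^{-1}_2(\mathbb{R})$ for all $n\in\mathbb{Z}$ and $\sup_n\|f\phi_n\|_{W^{-1}_2(\mathbb{R})}<\infty$. Every real-valued $q\in W^{-1}_{2,unif}(\mathbb{R})$ can be written (non-uniquely)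 as $q=\sigma'+\tau$ with real-valued $\sigma\in L_{2,unif}(\mathbb{R})$, $\tau\in L_{1,unif}(\mathbb{R})$, where the derivative is in the sense of distributions. All potentials are real-valued elements of $W^{-1}_{2,unif}(\mathbb{R})$. Operator: for a real-valued $q=\sigma'+\tau\in W^{-1}_{2,unif}(\mathbb{R})$ with real-valued $\sigma\in L_{2,unif}(\mathbb{R})$ and $\tau\in L_{1,unif}(\mathbb{R})$ put $f^{[1]}:=f'-\sigma f$ and $l(f):=-(f'-\sigma f)'-\sigma f'+\tau f$. The operator $S$ in $L_2(\mathbb{R})$ is defined by $Sf=l(f)$ on $$\mathfrak{D}(S)=\{f\in W^1_2(\mathbb{R}) : f^{[1]}\in W^1_{1,loc}(\mathbb{R}),\ l(f)\in L_2(\mathbb{R})\}.$$ It does not depend on the choice of $\sigma,\tau$ in the decomposition of $q$. Singular Gordon potential: $q=\sigma'+\tau\in W^{-1}_{2,unif}(\mathbb{R})$ with $\sigma\in L_{2,unif}(\mathbb{R})$ and $\tau\in L_{1,unif}(\mathbb{R})$ is called a singular Gordon potential if there exist numbers $T_m>0$ with $T_m\to\infty$ and $T_m$-periodic functions $\sigma_m\in L_{2,unif}(\mathbb{R})$, $\tau_m\in L_{1,unif}(\mathbb{R})$ such that for every $C<\infty$ $$\lim_{m\to\infty}\exp(CT_m)\Bigl\{\|\sigma-\sigma_m\|_{L_2[-T_m,2T_m]}+\|\tau-\tau_m\|_{L_1[-T_m,2T_m]}\Bigr\}=0.$$ *)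

(* Defs.v *)
From HB Require Import structures.
From mathcomp Require Import all_boot all_order all_algebra.
From mathcomp Require Import complex.
From mathcomp Require Import all_classical all_reals all_analysis.

Set Implicit Arguments.
Unset Strict Implicit.
Unset Printing Implicit Defensive.

Import Order.TTheory GRing.Theory Num.Theory.
Import numFieldNormedType.Exports.

Local Open Scope classical_set_scope.
Local Open Scope ring_scope.
Local Open Scope complex_scope.

Definition modulus (R : realType) (z : R[i]) : R := ComplexField.Normc.normc z.

(* R[i] carries no sigma-algebra in the library: measurability of
   complex-valued functions is measurability of both components. *)
Definition cmeasurable (R : realType) (f : R -> R[i]) : Prop :=
  measurable_fun [set: R] (fun t => complex.Re (f t)) /\
  measurable_fun [set: R] (fun t => complex.Im (f t)).

Definition real_valued (R : realType) (f : R -> R[i]) : Prop :=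
  forall t, f t \is Num.real.

Definition Lp_norm (R : realType) (p : R) (A : set R) (f : R -> R[i]) : \bar R :=
  Lnorm (@lebesgue_measure R) p%:E
    ((fun t => (modulus (f t))%:E) \_ A).

Definition Lp (R : realType) (p : R) (f : R -> R[i]) : Prop :=
  cmeasurable f /\ (Lp_norm p [set: R] f < +oo)%E.

Definition Lp_unif_norm (R : realType) (p : R) (f : R -> R[i]) : \bar R :=
  ereal_sup [set Lp_norm p `[t, t + 1]%classic f | t in [set: R]].

Definition Lp_unif (R : realType) (p : R) (f : R -> R[i]) : Prop :=
  cmeasurable f /\ (Lp_unif_norm p f < +oo)%E.

Definition L1_loc (R : realType) (f : R -> R[i]) : Prop :=
  locally_integrable [set: R] (fun t => complex.Re (f t)) /\
  locally_integrable [set: R] (fun t => complex.Im (f t)).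

(* Real test functions suffice: a complex one is phi1 + i phi2, and the
   defining identity of the weak derivative is linear in phi. *)
Definition test_function (R : realType) (phi : R -> R) : Prop :=
  (forall (n : nat) (t : R), derivable (derive1n n phi) t 1) /\
  compact (closure [set t | phi t != 0]).

Definition cintegral (R : realType) (f : R -> R[i]) : R[i] :=
  Rintegral (@lebesgue_measure R) [set: R] (fun t => complex.Re (f t)) +i*
  Rintegral (@lebesgue_measure R) [set: R] (fun t => complex.Im (f t)).

Definition weak_derivative (R : realType) (f g : R -> R[i]) : Prop :=
  [/\ L1_loc f, L1_loc g &
      forall phi : R -> R, test_function phi ->
        cintegral (fun t => f t * (derive1 phi t)%:C) =
        - cintegral (fun t => g t * (phi t)%:C)].

Definition weakly_derivable (R : realType) (f : R -> R[i]) : Prop :=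
  exists g, weak_derivative f g.

(* A representative of the (a.e. unique) weak derivative; meaningful only
   when f is weakly derivable. *)
Definition Dw (R : realType) (f : R -> R[i]) : R -> R[i] :=
  xget (fun=> 0) [set g | weak_derivative f g].

Definition W12 (R : realType) (f : R -> R[i]) : Prop :=
  [/\ Lp 2 f, weakly_derivable f & Lp 2 (Dw f)].

Definition abs_continuous_on (R : realType) (a b : R) (f : R -> R[i]) : Prop :=
  forall e : R, 0 < e -> exists2 d : R, 0 < d &
    forall (n : nat) (x y : 'I_n -> R),
      (forall k, a <= x k /\ x k <= y k /\ y k <= b) ->
      trivIset [set: 'I_n] (fun k => `]x k, y k[%classic) ->
      \sum_(k < n) (y k - x k) < d ->
      \sum_(k < n) modulus (f (y k) - f (x k)) < e.

Definition loc_abs_continuous (R : realType) (f : R -> R[i]) : Prop :=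
  forall a b : R, a <= b -> abs_continuous_on a b f.

(* As f is only an a.e. class (it will be f' - sigma f), absolute continuity is
   asked of a representative.  A locally absolutely continuous function is always
   weakly derivable; the first conjunct records it so that Dw f is never the
   default value of xget. *)
Definition W11loc (R : realType) (f : R -> R[i]) : Prop :=
  weakly_derivable f /\
  exists2 h : R -> R[i], loc_abs_continuous h &
    ae_eq (@lebesgue_measure R) [set: R] f h.

(* The potential is the distribution q = sigma' + tau, given by the pair
   (sigma, tau): on smooth data - (f' - sigma f)' - sigma f' + tau f
   is - f'' + (sigma' + tau) f. *)
Definition quasi_derivative (R : realType) (sigma f : R -> R[i]) : R -> R[i] :=
  fun t => Dw f t - sigma t * f t.

Definition schrodinger_expr (R : realType) (sigma tau f : R -> R[i]) :
    R -> R[i] :=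
  fun t => - Dw (quasi_derivative sigma f) t - sigma t * Dw f t + tau t * f t.

Definition schrodinger_dom (R : realType) (sigma tau : R -> R[i]) :
    set (R -> R[i]) :=
  [set f | [/\ W12 f, W11loc (quasi_derivative sigma f) &
               Lp 2 (schrodinger_expr sigma tau f)]].

(* Functions stand for their a.e. classes, so u <> 0 and S u = lambda u are
   statements in L_2. *)
Definition schrodinger_eigenvalue (R : realType) (sigma tau : R -> R[i])
    (lambda : R[i]) : Prop :=
  exists u : R -> R[i],
    [/\ schrodinger_dom sigma tau u,
        ~ ae_eq (@lebesgue_measure R) [set: R] u (fun=> 0) &
        ae_eq (@lebesgue_measure R) [set: R]
          (schrodinger_expr sigma tau u) (fun t => lambda * u t)].

Definition singular_gordon (R : realType) (sigma tau : R -> R[i]) : Prop :=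
  [/\ Lp_unif 2 sigma, Lp_unif 1 tau &
      exists (T : nat -> R) (sigma_ tau_ : nat -> R -> R[i]),
        [/\ forall m, 0 < T m,
            T m @[m --> \oo] --> +oo%R,
            forall m, Lp_unif 2 (sigma_ m) /\ periodic (sigma_ m) (T m),
            forall m, Lp_unif 1 (tau_ m) /\ periodic (tau_ m) (T m) &
            forall C : R,
              let I m := `[- T m, 2 * T m]%classic in
              let dsigma m t := sigma t - sigma_ m t in
              let dtau m t := tau t - tau_ m t in
              ((expR (C * T m))%:E *
                 (Lp_norm 2 (I m) (dsigma m) + Lp_norm 1 (I m) (dtau m)))%E
              @[m --> \oo] --> 0%E]].

(* Main.v *)
(* For an eigenfunction [u] and [Y = (u, u^[1])], the equation is a trace-free
   linear system [Y' = A Y] with locally integrable coefficients. Moreover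
   [Y(t) -> 0] as [|t| -> oo], since [u] and [u'] are in L_2 and [u^[1]] is
   bounded at [t] by its mean plus its variation over [[t, t + 1]]. The Wronskian
   of [u] and its conjugate then shows that the eigenvalue is real, so that [u]
   may be assumed real.

   Gordon's argument is applied to [Y] itself, without solving the periodic
   systems: the periodic approximants serve only to see that [A(t + T) - A(t)] is
   superexponentially small on [[- T, T]]. Put [Z(t) = Y(t + T) + Y(t - T)]. The
   Wronskian of [Y] and [Y(. + T)] is almost constant on [[- T, 0]], hence [Y(0)]
   and [Z(0)] are almost parallel: [Z(0) = D Y(0)] up to a small error. As
   [Z - D Y] almost solves the system on [[0, T]], Gronwall's inequality gives
   [Z(T) = D Y(T)] up to a small error. So [Y(T) + Y(- T)] is close to [D Y(0)]
   and [Y(2 T) + Y(0)] to [D Y(T)]; using the first if [|D| > 1] and the second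
   otherwise, [|Y(0)|] is at most [|Y(- T)| + |Y(T)| + |Y(2 T)|] plus a small
   error. Let [T -> oo]: [Y(0) = 0], and [u = 0] by uniqueness. *)

From mathcomp Require Import all_boot all_order all_algebra.
From mathcomp Require Import complex ring lra.
From mathcomp Require Import all_classical all_reals all_analysis.
From mathcomp Require Import measurable_realfun.
Require Import Defs.

Set Implicit Arguments.
Unset Strict Implicit.
Unset Printing Implicit Defensive.

Import Order.TTheory GRing.Theory Num.Theory.
Import numFieldNormedType.Exports.

Local Open Scope classical_set_scope.
Local Open Scope ring_scope.

(** * Integrals over compact intervals *)

Section LocalIntegral.
Context {R : realType}.
Local Notation mu := (@lebesgue_measure R).
Implicit Types (f g F G : R -> R) (a b c t : R).

(** Model case: if the coefficients are [T]-periodic, then [Y(t + T) + Y(t - T) = D Y(t)], where [D]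
    is the trace of the monodromy matrix [M]; this is [M + M^-1 = D], Cayley-Hamilton for
    determinant 1. Here [D] is read off the solution instead, as a quotient of components at 0. It
    has no a priori bound, so it must not enter the error terms. The low regularity shapes the
    estimates. Both [sigma] and [u' = sigma u + u^[1]] are only square integrable on bounded
    intervals, so products such as [sigma u'] can be controlled only through their integrals. Every
    differential equation is therefore kept in the integrated form [prim F f], and such products are
    split by a weighted arithmetic-geometric mean inequality. Gronwall's inequality on [[0, T]]
    costs a factor [exp (C0 (T + 1))], where [C0] depends only on the uniform bounds of the
    coefficients. The superexponential closeness in Gordon's condition has to beat this factor and
    the growth [T + 1] of the error integrals. *)

Definition locint f : Prop :=
  measurable_fun [set: R] f /\ forall a b, mu.-integrable `[a, b] (EFin \o f).

(* [itg f a b] is [0] when [b < a], not the oriented integral. *)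
Definition itg f a b : R := \int[mu]_(t in `[a, b]) f t.

Lemma locint_locally f : locally_integrable [set: R] f -> locint f.
Proof.
case=> mf _ fK; split=> // a b; apply/integrableP; split.
  exact/measurable_EFinP/measurable_funTS.
by apply: fK => //; exact: segment_compact.
Qed.

Lemma locintD f g : locint f -> locint g -> locint (fun t => f t + g t).
Proof.
move=> [mf If] [mg Ig]; split; first exact: measurable_funD.
move=> a b; exact: (integrableD _ (If a b) (Ig a b)).
Qed.

Lemma locintZ k f : locint f -> locint (fun t => k * f t).
Proof.
move=> [mf If]; split; first exact: measurable_funM.
move=> a b; exact: (integrableZl _ k (If a b)).
Qed.

Lemma locintN f : locint f -> locint (fun t => - f t).
Proof.
by move=> /(locintZ (-1)); under [X in locint X -> _]eq_fun do rewrite mulN1r.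
Qed.

Lemma locintB f g : locint f -> locint g -> locint (fun t => f t - g t).
Proof. by move=> lf /locintN; exact: locintD. Qed.

Lemma locint_dom f g : measurable_fun [set: R] f -> locint g ->
  (forall t, `|f t| <= g t) -> locint f.
Proof.
move=> mf [mg Ig] fg; split=> // a b.
apply: (le_integrable _ _ _ (Ig a b)) => //.
  exact/measurable_EFinP/measurable_funTS.
by move=> t _; rewrite /= lee_fin (le_trans (fg t)) // ler_norm.
Qed.

Lemma locint_sqrB f g : measurable_fun [set: R] f -> measurable_fun [set: R] g ->
  locint (fun t => f t ^+ 2) -> locint (fun t => g t ^+ 2) ->
  locint (fun t => (f t - g t) ^+ 2).
Proof.
move=> mf mg lf lg.
apply: (@locint_dom _ (fun t => 2 * (f t ^+ 2) + 2 * (g t ^+ 2))).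
- by apply: measurable_funX; exact: measurable_funB.
- by apply: locintD; exact: locintZ.
move=> t; rewrite ger0_norm ?sqr_ge0 //.
by have := sqr_ge0 (f t + g t); rewrite !expr2; lra.
Qed.

Lemma locint_abs f : locint f -> locint (fun t => `|f t|).
Proof.
move=> [mf If]; split; first by apply: measurableT_comp => //; exact: measurable_normr.
move=> a b; exact: (integrable_norm (If a b)).
Qed.

Lemma locint_cst k : locint (fun=> k).
Proof.
split; first exact: measurable_cst.
move=> a b; apply: continuous_compact_integrable; first exact: segment_compact.
by apply: continuous_subspaceT => x; exact: cvg_cst.
Qed.

Lemma locint_continuous f : continuous f -> locint f.
Proof.
move=> cf; split; first exact: continuous_measurable_fun.
move=> a b; apply: continuous_compact_integrable; first exact: segment_compact.
exact: continuous_subspaceT.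
Qed.

Lemma locint_integrable f : mu.-integrable [set: R] (EFin \o f) -> locint f.
Proof.
move=> If; split; first by apply/measurable_EFinP; exact: (measurable_int mu If).
by move=> a b; exact: integrableS If.
Qed.

Lemma itgD f g a b : locint f -> locint g ->
  itg (fun t => f t + g t) a b = itg f a b + itg g a b.
Proof. by move=> [_ If] [_ Ig]; rewrite /itg RintegralD. Qed.

Lemma itgB f g a b : locint f -> locint g ->
  itg (fun t => f t - g t) a b = itg f a b - itg g a b.
Proof. by move=> [_ If] [_ Ig]; rewrite /itg RintegralB. Qed.

Lemma itgZ k f a b : locint f -> itg (fun t => k * f t) a b = k * itg f a b.
Proof. by move=> [_ If]; rewrite /itg RintegralZl. Qed.

Lemma itg_le f g a b : locint f -> locint g ->
  (forall t, a <= t <= b -> f t <= g t) -> itg f a b <= itg g a b.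
Proof.
move=> [_ If] [_ Ig] fg; apply: le_Rintegral => // t /=.
Qed.

Lemma itg_ge0 f a b : (forall t, 0 <= f t) -> 0 <= itg f a b.
Proof. by move=> f0; apply: Rintegral_ge0. Qed.

Lemma itg_cst k a b : a <= b -> itg (fun=> k) a b = k * (b - a).
Proof.
move=> ab; rewrite /itg Rintegral_cst //= lebesgue_measure_itv /= lte_fin.
by move: ab; rewrite le_eqVlt => /predU1P[->|->]; rewrite ?ltxx ?subrr ?mulr0.
Qed.

Lemma itg_abs f a b : locint f -> `|itg f a b| <= itg (fun t => `|f t|) a b.
Proof. by move=> [_ If]; exact: le_normr_Rintegral. Qed.

Lemma itgxx f a : itg f a a = 0.
Proof. by rewrite /itg set_itv1 Rintegral_set1. Qed.

Lemma itg_split f a b c : locint f -> a <= b -> b <= c ->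
  itg f a c = itg f a b + itg f b c.
Proof.
move=> [_ If] ab bc; apply/eqP; rewrite addrC -subr_eq; apply/eqP.
rewrite /itg Rintegral_itvB ?bnd_simp //.
rewrite Rintegral_itv_obnd_cbnd //.
by apply: integrableS (If b c) => //; exact: subset_itv_oc_cc.
Qed.

Lemma itg_sub f a b c d : locint f -> (forall t, 0 <= f t) ->
  a <= b -> b <= c -> c <= d -> itg f b c <= itg f a d.
Proof.
move=> lf f0 ab bc cd.
rewrite (itg_split lf ab (le_trans bc cd)) (itg_split lf bc cd).
by have := itg_ge0 a b f0; have := itg_ge0 c d f0; lra.
Qed.

Lemma itg_ae f g a b : locint f -> locint g -> ae_eq mu [set: R] f g ->
  itg f a b = itg g a b.
Proof.
move=> [mf _] [mg _] fg; rewrite /itg /Rintegral; congr fine.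
apply: ae_eq_integral => //; [exact/measurable_EFinP/measurable_funTS..|].
by apply: filterS fg => t /= + _ => /(_ I) ->.
Qed.

Lemma itg_small f a b e : locint f -> 0 < e -> exists2 d, 0 < d &
  forall s t, a <= s -> s <= t -> t <= b -> t - s < d ->
    itg (fun t => `|f t|) s t < e.
Proof.
move=> [mf If] e0.
(* The restriction of [f] to [[a, b]] is integrable on the whole line, so that absolute continuity
   of its integral gives one [d] for all subintervals. *)
have Ir : mu.-integrable [set: R] (EFin \o (f \_ `[a, b])).
  by rewrite -restrict_EFin; apply/integrable_restrict => //; rewrite setTI.
have [d [d0 dP]] := integral_normr_continuous Ir e0.
exists d => // s t as_ st tb tsd.
have /= := dP `[s, t]%classic (measurable_itv _).
rewrite lebesgue_measure_itv /= lte_fin.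
have -> : (\int[mu]_(x in `[s, t]) `|(f \_ `[a, b]) x|)%R = itg (fun t => `|f t|) s t.
  apply: eq_Rintegral => x; rewrite inE /= in_itv /= => /andP[sx xt].
  by rewrite patchE mem_set //= in_itv /= (le_trans as_ sx) (le_trans xt tb).
by apply; case: (ltP s t) => _; rewrite lte_fin.
Qed.

End LocalIntegral.

(** * Translation invariance of the integral *)

Section Translation.
Context {R : realType}.
Local Notation mu := (@lebesgue_measure R).
Implicit Types (f : R -> R) (a b T : R).

Let shift T : measurableTypeR R -> measurableTypeR R := fun t => t + T.

Let measurable_shift T : measurable_fun [set: measurableTypeR R] (shift T).
Proof. by apply: measurable_funD => //; exact: measurable_cst. Qed.

Let shift_preimage T a b : shift T @^-1` `[a + T, b + T] = `[a, b]%classic.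
Proof. by apply/seteqP; split=> t /=; rewrite !in_itv /= !lerD2r. Qed.

Lemma pushforward_shift T A : measurable A ->
  mu A = pushforward mu (shift T) A.
Proof.
apply: (@lebesgue_measure_unique R
  (measure_function_pushforward__canonical__measure_function_Measure mu (measurable_shift T))).
move=> X /ocitvP[->|[[a b] /= ab ->]]; first by rewrite !measure0.
rewrite /= /pushforward.
have -> : shift T @^-1` `]a, b] = `]a - T, b - T]%classic.
  by apply/seteqP; split=> t /=; rewrite !in_itv /= /shift ltrBlDr lerBrDr.
rewrite !lebesgue_measure_itv /= !lte_fin ltrD2r ab -!EFinB.
by congr (_%:E); ring.
Qed.

(** The nonnegative case comes first: applied to [|f|], it yields the integrability that the signed
    change of variables in [itg_shift] requires. *)
Let le0_shift f T a b : measurable_fun [set: R] f -> (forall t, 0 <= f t) ->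
  (\int[mu]_(t in `[(a + T)%R, (b + T)%R]) (f t)%:E =
   \int[mu]_(t in `[a, b]) (f (t + T)%R)%:E)%E.
Proof.
move=> mf f0; rewrite -(shift_preimage T a b).
rewrite -(@ge0_integral_pushforward _ _ _ _ _ _ (measurable_shift T) mu `[a + T, b + T]%classic (EFin \o f)) //.
- by apply: eq_measure_integral => A mA _; exact: pushforward_shift.
- exact/measurable_EFinP/measurable_funTS.
- by move=> t _; rewrite lee_fin.
Qed.

Lemma locint_shift f T : locint f -> locint (fun t => f (t + T)).
Proof.
move=> [mf If]; split; first exact: (measurableT_comp mf (measurable_shift T)).
move=> a b; apply/integrableP; split.
  apply/measurable_EFinP/measurable_funTS.
  exact: (measurableT_comp mf (measurable_shift T)).
have := le0_shift T a b (measurableT_comp (@normr_measurable R setT) mf) (fun t => normr_ge0 (f t)).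
move=> /= <-; have /integrableP[_] := If (a + T) (b + T).
by under eq_integral do rewrite /=.
Qed.

Lemma itg_shift f T a b : locint f ->
  itg (fun t => f (t + T)) a b = itg f (a + T) (b + T).
Proof.
move=> lf; rewrite /itg /Rintegral; congr fine.
rewrite -(shift_preimage T a b).
have := (@integral_pushforward _ _ _ _ _ _ (measurable_shift T) mu `[a + T, b + T]%classic (EFin \o f)).
move=> <- //.
- by apply: eq_measure_integral => A mA _; exact/esym/pushforward_shift.
- by case: lf => mf _; exact/measurable_EFinP.
- by rewrite shift_preimage; case: (locint_shift T lf) => _; exact.
Qed.

End Translation.

(** * Locally absolutely continuous functions *)

Section Primitives.
Context {R : realType}.
Local Notation mu := (@lebesgue_measure R).
Implicit Types (f g F G : R -> R) (a b c d s t k : R).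

(* [F] is locally absolutely continuous with a.e. derivative [f]. *)
Definition prim F f : Prop :=
  locint f /\ forall a b, a <= b -> F b - F a = itg f a b.

Lemma primD F f G g : prim F f -> prim G g ->
  prim (fun t => F t + G t) (fun t => f t + g t).
Proof.
move=> [lf Ff] [lg Gg]; split; first exact: locintD.
by move=> a b ab; rewrite itgD // -Ff // -Gg //; ring.
Qed.

Lemma primZ k F f : prim F f -> prim (fun t => k * F t) (fun t => k * f t).
Proof.
move=> [lf Ff]; split; first exact: locintZ.
by move=> a b ab; rewrite itgZ // -Ff //; ring.
Qed.

Lemma primB F f G g : prim F f -> prim G g ->
  prim (fun t => F t - G t) (fun t => f t - g t).
Proof.
move=> [lf Ff] [lg Gg]; split; first exact: locintB.
by move=> a b ab; rewrite itgB // -Ff // -Gg //; ring.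
Qed.

Lemma prim_shift c F f : prim F f ->
  prim (fun t => F (t + c)) (fun t => f (t + c)).
Proof.
move=> [lf Ff]; split; first exact: locint_shift.
by move=> a b ab; rewrite itg_shift // Ff // lerD2r.
Qed.

Lemma prim_ae F f g : prim F f -> locint g -> ae_eq mu [set: R] f g -> prim F g.
Proof.
by move=> [lf Ff] lg fg; split=> // a b ab; rewrite Ff //; exact: itg_ae.
Qed.

Lemma prim_dist F f a b : prim F f -> a <= b ->
  `|F b - F a| <= itg (fun t => `|f t|) a b.
Proof. by move=> [lf Ff] ab; rewrite Ff //; exact: itg_abs. Qed.

Lemma prim_small F f a b e : prim F f -> 0 < e -> exists2 d, 0 < d &
  forall s t, a <= s <= b -> a <= t <= b -> `|t - s| < d -> `|F t - F s| < e.
Proof.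
move=> pF e0; have [d d0 dP] := itg_small a b pF.1 e0; exists d => // s t.
wlog st : s t / s <= t.
  move=> H sab tab std; have [st|ts] := leP s t; first exact: H.
  by rewrite distrC; apply: H => //; [exact: ltW|rewrite distrC].
move=> /andP[as_ sb] /andP[at_ tb]; rewrite ger0_norm ?subr_ge0 // => std.
by apply: le_lt_trans (prim_dist pF st) _; exact: dP.
Qed.

Lemma prim_continuous F f : prim F f -> continuous F.
Proof.
move=> pF x; apply/cvgrPdist_lt => e e0.
have [d d0 dP] := prim_small (x - 1) (x + 1) pF e0.
apply/nbhs_ballP; exists (Num.min 1 d); first by rewrite /= lt_min ltr01.
move=> y; rewrite /ball /= lt_min => /andP[y1 yd].
have /andP[y2 y3] : x - 1 <= y <= x + 1.
  by move: y1; rewrite ltr_norml => /andP[y1 y2]; apply/andP; split; lra.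
by apply: dP; rewrite ?y2 ?y3 //; apply/andP; split; lra.
Qed.

Lemma prim_measurable F f : prim F f -> measurable_fun [set: R] F.
Proof. by move/prim_continuous; exact: continuous_measurable_fun. Qed.

Lemma continuous_bounded_itv F a b : continuous F ->
  exists2 M, 0 <= M & forall t, a <= t <= b -> `|F t| <= M.
Proof.
move=> cF; have [ab|ba] := leP a b; last first.
  by exists 0 => // t /andP[at_ tb]; have := le_trans at_ tb; rewrite leNgt ba.
have cN : {within `[a, b], continuous (fun t => `|F t|)}.
  apply: continuous_subspaceT => x.
  by apply: (@continuous_comp _ _ _ F (fun y => `|y|)); [exact: cF|exact: norm_continuous].
have [c _ cP] := EVT_max ab cN.
by exists `|F c| => // t tab; apply: cP; rewrite in_itv.
Qed.

Lemma locintMc F f : continuous F -> locint f -> locint (fun t => F t * f t).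
Proof.
move=> cF [mf If]; have mF := continuous_measurable_fun cF.
have mFf : measurable_fun [set: R] (fun t => F t * f t) by exact: measurable_funM.
split=> // a b; have [M M0 FM] := continuous_bounded_itv a b cF.
apply: (le_integrable _ _ _ (integrableZl _ M (integrable_norm (If a b)))) => //.
  exact/measurable_EFinP/measurable_funTS.
move=> t /=; rewrite in_itv /= => tab; rewrite /= lee_fin normrM.
by rewrite (ger0_norm (mulr_ge0 M0 (normr_ge0 _))) ler_wpM2r // FM.
Qed.

(** Continuation by steps of length [d / 2], which stay strictly below [d]. It turns estimates on
    short intervals into estimates on [[a, b]], both for the product rule and for Gronwall's
    inequality. *)
Lemma interval_chain (Q : R -> R -> Prop) a b d : 0 < d -> a <= b ->
  (forall s t c, a <= s -> s <= t -> t <= c -> c <= b -> Q s t -> Q t c -> Q s c) ->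
  (forall s t, a <= s -> s <= t -> t <= b -> t - s < d -> Q s t) -> Q a b.
Proof.
move=> d0 ab trans loc.
have step n : forall t, a <= t -> t <= b -> t - a <= n%:R * (d / 2) -> Q a t.
  elim: n => [|n IH] t at_ tb tn; first by apply: loc => //; move: tn; lra.
  have [ta|ta] := leP (t - a) (d / 2); first by apply: loc => //; lra.
  have h1 : a <= t - d / 2 by lra.
  have h2 : t - d / 2 <= t by lra.
  apply: (trans a (t - d / 2) t) => //.
    apply: IH => //; first by lra.
    by move: tn; rewrite -natr1 mulrDl; lra.
  by apply: loc => //; lra.
apply: (step (Num.bound ((b - a) / (d / 2)))) => //.
rewrite -ler_pdivrMr; last by lra.
by apply: ltW; apply: archi_boundP; rewrite divr_ge0 //; lra.
Qed.

(** On an interval where [F] and [G] oscillate by less than [e], the product rule fails by at most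
    [e] times the integral of [|f| + |g|]. This bound is additive over adjacent intervals, so it
    passes to [[a, b]], and [e] is arbitrary. Neither Fubini's theorem nor differentiation almost
    everywhere is involved. *)
Lemma primM F f G g : prim F f -> prim G g ->
  prim (fun t => F t * G t) (fun t => G t * f t + F t * g t).
Proof.
move=> pF pG; have [[lf Ff] [lg Gg]] := (pF, pG).
have cF := prim_continuous pF; have cG := prim_continuous pG.
have lGf := locintMc cG lf; have lFg := locintMc cF lg.
have lh := locintD lGf lFg.
split=> // a b ab.
have la := locintD (locint_abs lf) (locint_abs lg).
have err e : 0 < e -> `|F b * G b - F a * G a -
    itg (fun t => G t * f t + F t * g t) a b| <=
    e * itg (fun t => `|f t| + `|g t|) a b.
  move=> e0; have [d1 d10 d1P] := prim_small a b pF e0.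
  have [d2 d20 d2P] := prim_small a b pG e0.
  apply: (@interval_chain (fun s t => `|F t * G t - F s * G s -
    itg (fun t => G t * f t + F t * g t) s t| <=
    e * itg (fun t => `|f t| + `|g t|) s t) a b (Num.min d1 d2)) => //.
  - by rewrite lt_min d10.
  - move=> s t c _ st tc _ h1 h2; rewrite (itg_split lh st tc) (itg_split la st tc).
    rewrite mulrDr; apply: le_trans (lerD h1 h2); apply: le_trans (ler_normD _ _).
    by rewrite le_eqVlt; apply/orP; left; apply/eqP; congr `|_|; ring.
  move=> s t as_ st tb; rewrite lt_min => /andP[t1 t2].
  (* The increment is [G t (F t - F s) + F s (G t - G s)], with the factors [G t] and [F s] frozen
     at the end points; what remains is the oscillation of [F] and [G] over [[s, t]]. *)
  have -> : F t * G t - F s * G s - itg (fun t => G t * f t + F t * g t) s t =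
      itg (fun r => (G t - G r) * f r + (F s - F r) * g r) s t.
    have E : F t * G t - F s * G s = itg (fun r => G t * f r + F s * g r) s t.
      rewrite (itgD _ _ (locintZ (G t) lf) (locintZ (F s) lg)) !itgZ //.
      by rewrite -(Ff _ _ st) -(Gg _ _ st); ring.
    rewrite E -itgB //; last by apply: locintD; exact: locintZ.
    by congr itg; apply/funext => r; ring.
  have cc (H : R -> R) u : continuous H -> continuous (fun r => u - H r).
    by move=> cH x; apply: cvgB; [exact: cvg_cst|exact: cH].
  have l1 := locintMc (cc _ (G t) cG) lf; have l2 := locintMc (cc _ (F s) cF) lg.
  apply: le_trans (itg_abs _ _ (locintD l1 l2)) _.
  rewrite -itgZ //; apply: itg_le; [exact/locint_abs/locintD|exact: locintZ|].
  move=> r /andP[sr rt]; rewrite mulrDr (le_trans (ler_normD _ _)) //.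
  rewrite !normrM; apply: lerD; apply: ler_wpM2r => //; apply: ltW.
    by apply: d2P; [apply/andP; split; lra..|rewrite ger0_norm; lra].
  by apply: d1P; [apply/andP; split; lra..|rewrite ler0_norm; lra].
apply/eqP; rewrite -subr_eq0 -normr_le0; apply/ler_addgt0Pr => e e0; rewrite add0r.
set J := itg (fun t => `|f t| + `|g t|) a b in err.
have J0 : 0 <= J by apply: itg_ge0 => t; exact: addr_ge0.
have J1 : 0 < J + 1 by lra.
apply: le_trans (err (e / (J + 1)) (divr_gt0 e0 J1)) _.
by rewrite mulrAC ler_pdivrMr // ler_pM2l //; lra.
Qed.

End Primitives.

(** * Gronwall's inequality, forward and backward *)

Section Gronwall.
Context {R : realType}.
Implicit Types (N al rho : R -> R) (a b s t : R).

(** Here [m] stands for the maximum over a short interval and [h] for the integral of the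
    coefficient. The term [h * m] is absorbed on the left, and [1 / (1 - h) <= 1 + 2 h <= exp (2 h)]
    for [h <= 1/2] is the origin of the factor 2 in the exponent. *)
Let gronwall_step (h n m r : R) : 0 <= h -> h <= 2^-1 -> 0 <= n -> 0 <= r ->
  m <= n + h * m + r -> m <= (n + r) * expR (2 * h).
Proof.
move=> h0 h2 n0 r0 H.
have e1 := expR_ge1Dx (2 * h).
have h1 : 1 <= (1 - h) * expR (2 * h).
  apply: le_trans (_ : (1 - h) * (1 + 2 * h) <= _); first by nra.
  by rewrite ler_wpM2l //; lra.
have nr : 0 <= n + r by lra.
have e0 := expR_gt0 (2 * h).
have : m * (1 - h) <= n + r by lra.
move=> /(ler_wpM2r (ltW e0)); rewrite -mulrA => H1.
have [m0|m0] := leP m 0; first by apply: le_trans m0 _; rewrite mulr_ge0 // ltW.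
by apply: le_trans H1; rewrite ler_peMr // ltW.
Qed.

Let gronwall_trans (ns nt nc I1 I2 X Y : R) : 0 <= I2 -> 1 <= X -> 1 <= Y ->
  nt <= (ns + I1) * X -> nc <= (nt + I2) * Y ->
  nc <= (ns + (I1 + I2)) * (X * Y).
Proof.
move=> I20 X1 Y1 A B; apply: le_trans B _; rewrite mulrA.
have h : I2 <= I2 * X by rewrite ler_peMr.
by apply: ler_wpM2r; lra.
Qed.

(** On an interval where [al] has integral at most 1/2, compare both end values with the maximum of
    [N]; the resulting factors multiply along a chain of such intervals. The hypothesis is symmetric
    in the two end points, so the backward estimate comes along; uniqueness on the negative
    half-line uses it. *)
Lemma gronwall N al rho a b : continuous N -> (forall t, 0 <= N t) ->
  locint al -> (forall t, 0 <= al t) -> locint rho -> (forall t, 0 <= rho t) ->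
  (forall s t, a <= s -> s <= t -> t <= b ->
    `|N t - N s| <= itg (fun r => N r * al r + rho r) s t) ->
  a <= b ->
  N b <= (N a + itg rho a b) * expR (2 * itg al a b) /\
  N a <= (N b + itg rho a b) * expR (2 * itg al a b).
Proof.
move=> cN N0 lal al0 lrho rho0 H ab.
have h20 : (0 : R) < 2^-1 by rewrite invr_gt0; lra.
have [d d0 dP] := itg_small a b lal h20.
apply: (@interval_chain _ (fun s t =>
  N t <= (N s + itg rho s t) * expR (2 * itg al s t) /\
  N s <= (N t + itg rho s t) * expR (2 * itg al s t)) a b d d0 ab).
- move=> s t c _ st tc _ [A1 A2] [B1 B2].
  rewrite (itg_split lal st tc) (itg_split lrho st tc) mulrDr expRD.
  have X1 : 1 <= expR (2 * itg al s t).
    by rewrite -expR0 ler_expR; apply: mulr_ge0 => //; exact: itg_ge0.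
  have Y1 : 1 <= expR (2 * itg al t c).
    by rewrite -expR0 ler_expR; apply: mulr_ge0 => //; exact: itg_ge0.
  have I1 : 0 <= itg rho s t by exact: itg_ge0.
  have I2 : 0 <= itg rho t c by exact: itg_ge0.
  split; first exact: gronwall_trans A1 B1.
  rewrite (mulrC (expR _)) (addrC (itg rho s t)).
  exact: gronwall_trans B2 A2.
move=> s t as_ st tb std.
have h0 : 0 <= itg al s t by exact: itg_ge0.
have r0 : 0 <= itg rho s t by exact: itg_ge0.
have hle : itg al s t <= 2^-1.
  apply: ltW; have := dP s t as_ st tb std.
  by under eq_fun do rewrite ger0_norm //.
have [m /itvP mst mP] := EVT_max st (continuous_subspaceT cN).
have NM r : s <= r <= t -> N r <= N m by move=> rst; apply: mP; rewrite in_itv.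
have M_le u v : s <= u -> u <= v -> v <= t ->
    itg (fun r => N r * al r + rho r) u v <= itg al s t * N m + itg rho s t.
  move=> su uv vt; have lNal := locintMc cN lal.
  apply: (@le_trans _ _ (itg (fun r => N m * al r + rho r) u v)).
    apply: itg_le; [exact: locintD|exact/locintD/lrho/locintZ|].
    move=> r /andP[ur rv]; rewrite lerD2r ler_wpM2r // NM //.
    by rewrite (le_trans su ur) (le_trans rv vt).
  rewrite (itgD _ _ (locintZ (N m) lal) lrho) itgZ // mulrC.
  apply: lerD; first by rewrite ler_wpM2r // itg_sub.
  exact: itg_sub.
have [sm mt] : s <= m /\ m <= t by rewrite !mst.
have le1 : N m <= (N s + itg rho s t) * expR (2 * itg al s t).
  apply: gronwall_step => //.
  have := H s m as_ sm (le_trans mt tb); have := M_le s m (lexx _) sm mt.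
  by move=> h1 h2; have := le_trans (ler_norm _) (le_trans h2 h1); lra.
have le2 : N m <= (N t + itg rho s t) * expR (2 * itg al s t).
  apply: gronwall_step => //.
  have := H m t (le_trans as_ sm) mt tb; have := M_le m t sm mt (lexx _).
  rewrite distrC.
  by move=> h1 h2; have := le_trans (ler_norm _) (le_trans h2 h1); lra.
by split; [apply: le_trans le1|apply: le_trans le2]; apply: NM; rewrite lexx st.
Qed.

End Gronwall.

(** * Weak derivatives *)

Section SmoothBump.
Context {R : realType}.
Implicit Types (f g df : R -> R) (p : {poly R}) (a b c k s t x : R) (n : nat).



(** The recursion differentiates [f] first, so an induction on [n] only needs an explicit first
    derivative; [nderivable_derivable] goes back to the iterated derivatives of test functions. *)
Fixpoint nderivable n f : Prop :=
  if n is m.+1 then (forall t, derivable f t 1) /\ nderivable m (derive1 f) else True.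

Lemma nderivable_intro n f df : (forall t, is_derive t 1 f (df t)) ->
  nderivable n df -> nderivable n.+1 f.
Proof.
move=> fdf ndf; split; first by move=> t; case: (fdf t).
suff -> : derive1 f = df by [].
by apply/funext => t; rewrite derive1E; case: (fdf t).
Qed.

Lemma nderivableW n f : nderivable n.+1 f -> nderivable n f.
Proof. by elim: n f => [//|n IH] f [df /IH]. Qed.

Lemma nderivable_is_derive n f t : nderivable n.+1 f -> is_derive t 1 f (derive1 f t).
Proof. by move=> [df _]; rewrite derive1E; exact/derivableP. Qed.

Lemma nderivableD n f g : nderivable n f -> nderivable n g ->
  nderivable n (fun t => f t + g t).
Proof.
elim: n f g => [//|n IH] f g nf ng.
apply: (@nderivable_intro n _ (fun t => derive1 f t + derive1 g t)); last first.
  by apply: IH; [case: nf|case: ng].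
move=> t; have := nderivable_is_derive t nf; have := nderivable_is_derive t ng.
by move=> ? ?; exact: is_deriveD.
Qed.

Lemma nderivableM n f g : nderivable n f -> nderivable n g ->
  nderivable n (fun t => f t * g t).
Proof.
elim: n f g => [//|n IH] f g nf ng.
apply: (@nderivable_intro n _ (fun t => f t * derive1 g t + g t * derive1 f t)); last first.
  by apply: nderivableD; apply: IH; [exact: nderivableW|case: ng|exact: nderivableW|case: nf].
move=> t; have := nderivable_is_derive t nf; have := nderivable_is_derive t ng.
by move=> ? ?; exact: is_deriveM.
Qed.

Lemma nderivable_cst n k : nderivable n (fun=> k).
Proof.
elim: n k => [//|n IH] k; apply: (@nderivable_intro n _ (fun=> 0)) => //.
Qed.

Lemma is_derive_affine f (l : R) k c t : is_derive (k * t + c) 1 f l ->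
  is_derive t 1 (fun t => f (k * t + c)) (k * l).
Proof.
move=> H; have h : is_derive t 1 (fun t => k * t + c) k.
  have h1 : is_derive t 1 (k \*: (@id R^o) + cst c) (k *: (1 : R^o) + 0).
    exact: is_deriveD.
  by rewrite addr0 [_ *: _]mulr1 in h1.
by rewrite mulrC; exact: (@is_derive1_comp _ f (fun t => k * t + c)).
Qed.

Lemma nderivable_affine n f k c : nderivable n f ->
  nderivable n (fun t => f (k * t + c)).
Proof.
elim: n f => [//|n IH] f nf.
apply: (@nderivable_intro n _ (fun t => k * derive1 f (k * t + c))).
  by move=> t; apply: is_derive_affine; exact: nderivable_is_derive nf.
apply: nderivableM; first exact: nderivable_cst.
by apply: IH; case: nf.
Qed.

Lemma nderivable_derivable f : (forall n, nderivable n f) ->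
  forall n t, derivable (derive1n n f) t 1.
Proof.
move=> nf n; have : nderivable n.+1 f by [].
elim: n f {nf} => [|n IH] f; first by case.
by move=> [_ /IH]; rewrite /derive1n iterSr.
Qed.

Lemma is_derive_eps f t (l : R) : (forall e, 0 < e -> exists2 d, 0 < d &
    forall h, `|h| < d -> `|f (t + h) - f t - h * l| <= e * `|h|) ->
  is_derive t 1 f l.
Proof.
move=> H; suff L : (fun h => h^-1 *: ((f \o shift t) (h *: 1) - f t)) @ 0^' --> l.
  by apply: DeriveDef; [exact: cvgP L|exact: cvg_lim L].
apply/cvgrPdist_le => e e0; have [d d0 dP] := H e e0.
apply/nbhs_ballP; exists d => //= h; rewrite /ball /= sub0r normrN => hd h0.
rewrite distrC -(ler_pM2l (_ : 0 < `|h|)) ?normr_gt0 // mulrC -normrM (mulrC _ e).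
apply: le_trans (dP h hd); rewrite [h *: 1]mulr1 [h + t]addrC.
rewrite /GRing.scale /=; rewrite mulrBl mulrAC mulVf // mul1r (mulrC l).
by [].
Qed.

(** Raise [x / n <= exp (x / n)] to the power [n]. *)
Lemma expR_ge_pow n x : 0 <= x -> x ^+ n <= n%:R ^+ n * expR x.
Proof.
case: n => [|n] x0; first by rewrite !expr0 mul1r -expR0 ler_expR.
have n0 : (0 : R) < n.+1%:R by rewrite ltr0n.
have -> : expR x = expR (x / n.+1%:R) ^+ n.+1.
  by rewrite -expRM_natl; congr expR; field; rewrite lt0r_neq0.
rewrite -exprMn lerXn2r ?nnegrE //.
have H := ler_wpM2l (ltW n0) (expR_ge1Dx (x / n.+1%:R)); apply: le_trans H.
by rewrite mulrDr mulr1 [_ * (x / _)]mulrC divfK ?lt0r_neq0 // lerDr ltW.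
Qed.

(** Meant for [x = 1 / t] with [t] tending to [0] from the right. The power [x ^+ n] is carried
    along so that the induction on [p] can absorb the new factor ['X] into it. *)
Lemma poly_expRN_bounded p n : exists C, forall x, 0 <= x ->
  `|p.[x]| * x ^+ n * expR (- x) <= C.
Proof.
elim/poly_ind: p n => [|p c IH] n.
  by exists 0 => x _; rewrite horner0 normr0 !mul0r.
have [C PC] := IH n.+1; exists (C + `|c| * n%:R ^+ n) => x x0.
rewrite hornerMXaddC.
have e0 : 0 <= x ^+ n * expR (- x) by rewrite mulr_ge0 ?expR_ge0 ?exprn_ge0.
rewrite -mulrA; apply: le_trans (ler_wpM2r e0 (ler_normD _ _)) _.
rewrite mulrDl; apply: lerD.
  apply: le_trans (PC x x0); rewrite normrM (ger0_norm x0) exprS.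
  by rewrite le_eqVlt; apply/orP; left; apply/eqP; ring.
rewrite ler_wpM2l // expRN ler_pdivrMr ?expR_gt0 //.
exact: expR_ge_pow.
Qed.

(* Differentiation maps functions of this form to functions of this form, hence
   their smoothness. *)
Definition flat p t : R := if 0 < t then p.[t^-1] * expR (- t^-1) else 0.

Lemma is_derive_flat p t : is_derive t 1 (flat p) (flat ('X^2 * (p - p^`())) t).
Proof.
have [t0|t0|->] := ltgtP t 0.
- have -> : flat ('X^2 * (p - p^`())) t = 0 by rewrite /flat ltNge (ltW t0).
  apply: (@near_eq_is_derive _ _ _ (fun=> 0)).
  near=> y; rewrite /flat ltNge ltW //; near: y; exact: lt_nbhsl.
- have -> : flat ('X^2 * (p - p^`())) t =
      t^-1 ^+ 2 * (p.[t^-1] - p^`().[t^-1]) * expR (- t^-1).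
    by rewrite /flat t0 !hornerE.
  apply: (@near_eq_is_derive _ _ _ (fun t => p.[t^-1] * expR (- t^-1))).
    near=> y; rewrite /flat ifT //; near: y; exact: lt_nbhsr.
  have tn0 : t != 0 by rewrite gt_eqF.
  have hV : is_derive t 1 (fun t : R => t^-1) (- t ^- 2).
    by have := @is_deriveV _ id t 1 1 tn0 (is_derive_id _ _); rewrite [_ *: _]mulr1.
  have hp : is_derive t 1 (fun t => p.[t^-1]) (p^`().[t^-1] * - t ^- 2).
    exact: (@is_derive1_comp _ (horner p) (fun t => t^-1)).
  have hN : is_derive t 1 (fun t : R => - t^-1) (t ^- 2).
    by rewrite -[t ^- 2]opprK; exact: is_deriveN.
  have he : is_derive t 1 (fun t => expR (- t^-1)) (expR (- t^-1) * t ^- 2).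
    exact: (@is_derive1_comp _ expR (fun t => - t^-1)).
  have := @is_deriveM _ _ (fun t => p.[t^-1]) (fun t => expR (- t^-1)) t 1 _ _ hp he.
  move=> H; apply: (is_derive_eq H); rewrite -exprVn /GRing.scale /=; ring.
- have -> : flat ('X^2 * (p - p^`())) 0 = 0 by rewrite /flat ltxx.
  (* The exponent 2 gives [|flat p h| <= C h ^ 2] for [h > 0], hence derivative 0 at the origin. *)
  have [C HC] := poly_expRN_bounded p 2.
  have C0 : 0 <= C by apply: le_trans (HC 0 _) => //; rewrite expr0n mulr0 mul0r.
  apply: is_derive_eps => e e0.
  have C1 : 0 < C + 1 by lra.
  exists (e / (C + 1)); first exact: divr_gt0.
  move=> h hd; rewrite add0r mulr0 subr0 {2}/flat ltxx subr0 /flat.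
  case: ifP => h0; last by rewrite normr0 mulr_ge0 // ltW.
  have := HC h^-1; rewrite invr_ge0 (ltW h0) => /(_ isT).
  rewrite normrM (ger0_norm (expR_ge0 _)) mulrAC exprVn ler_pdivrMr ?exprn_gt0 //.
  move=> /le_trans; apply; move: hd; rewrite (gtr0_norm h0) ltr_pdivlMr // => hd.
  rewrite expr2; nra.
Unshelve. all: by end_near.
Qed.

End SmoothBump.

(** * A smooth step function *)

Section SmoothStep.
Context {R : realType}.
Implicit Types (f g F H rho : R -> R) (a b e s t M : R) (n : nat).

Definition primitive f t : R := if 0 <= t then itg f 0 t else - itg f t 0.

Lemma prim_primitive f : locint f -> prim (primitive f) f.
Proof.
move=> lf; split=> // a b ab; rewrite /primitive.
have [b0|b0] := leP 0 b; have [a0|a0] := leP 0 a.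
- by rewrite (itg_split lf a0 ab) addrAC subrr add0r.
- by rewrite opprK (itg_split lf (ltW a0) b0) addrC.
- by have := le_lt_trans (le_trans a0 ab) b0; rewrite ltxx.
- by rewrite (itg_split lf ab (ltW b0)) opprK addrC addrK.
Qed.

Lemma prim_is_derive F f t : prim F f -> continuous f -> is_derive t 1 F (f t).
Proof.
move=> [lf Ff] cf; apply: is_derive_eps => e e0.
have /cvgrPdist_lt/(_ e e0)/nbhs_ballP[d /= d0 dP] := cf t.
have small s : `|t - s| < d -> `|f s - f t| <= e.
  by move=> sd; rewrite distrC ltW //; apply: dP; rewrite /ball /= .
have key a b : a <= b -> (forall s, a <= s <= b -> `|t - s| < d) ->
    `|F b - F a - (b - a) * f t| <= e * (b - a).
  move=> ab sab; rewrite Ff // (mulrC (b - a)) -itg_cst // -itgB //; last exact: locint_cst.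
  rewrite -itg_cst //; apply: le_trans (itg_abs _ _ _) _.
    by apply: locintB => //; exact: locint_cst.
  apply: itg_le; [|exact: locint_cst|by move=> s /sab /small].
  by apply: locint_abs; apply: locintB => //; exact: locint_cst.
exists d => // h; have [h0|h0] := leP 0 h => hd.
  have := key t (t + h); rewrite (_ : t + h - t = h); last by ring.
  rewrite (ger0_norm h0) in hd *; apply; first by lra.
  by move=> s /andP[s1 s2]; rewrite ler0_norm; lra.
have := key (t + h) t; rewrite (_ : t - (t + h) = - h); last by ring.
move=> K; rewrite (ltr0_norm h0) in hd *.
have h1 : t + h <= t by lra.
have := K h1 _; rewrite -normrN.
rewrite (_ : - (F t - F (t + h) - - h * f t) = F (t + h) - F t - h * f t); last by ring.
by apply=> s /andP[s1 s2]; rewrite ger0_norm; lra.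
Qed.

Lemma prim_of_derive F f : (forall t, is_derive t 1 F (f t)) -> continuous f ->
  prim F f.
Proof.
move=> dF cf; have lf := locint_continuous cf.
have [_ PP] := prim_primitive lf; split=> // a b ab; rewrite -PP //.
have d0 t : is_derive t 1 (F - primitive f) (0 : R).
  rewrite -(subrr (f t)); apply: is_deriveB.
  by apply: prim_is_derive => //; exact: prim_primitive.
have := is_derive_0_is_cst b a d0; rewrite !fctE; lra.
Qed.

Lemma nderivable_continuous f : (forall n, nderivable n f) -> continuous f.
Proof.
by move=> nf t; apply: differentiable_continuous; apply/derivable1_diffP; case: (nf 1%N).
Qed.

(** On []-1, 1[] this is [exp (- 1 / (1 + t)) exp (- 1 / (1 - t))]; the arguments have the shape
    [k * t + c] of [nderivable_affine]. *)
Definition bump t : R := flat 1 (1 * t + 1) * flat 1 (-1 * t + 1).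

Lemma nderivable_flat n p : nderivable n (@flat R p).
Proof.
elim: n p => [//|n IH] p; apply: nderivable_intro (IH _); exact: is_derive_flat.
Qed.

Lemma nderivable_bump n : nderivable n bump.
Proof. by apply: nderivableM; apply: nderivable_affine; exact: nderivable_flat. Qed.

Lemma flat_ge0 t : 0 <= flat 1 t.
Proof. by rewrite /flat; case: ifP => // _; rewrite hornerC mul1r expR_ge0. Qed.

Lemma bump_ge0 t : 0 <= bump t.
Proof. by apply: mulr_ge0; exact: flat_ge0. Qed.

Lemma bump_gt0 t : -1 < t < 1 -> 0 < bump t.
Proof.
by move=> t1; apply: mulr_gt0; rewrite /flat ifT ?hornerC ?mul1r ?expR_gt0 //; lra.
Qed.

Lemma bump_out t : 1 <= `|t| -> bump t = 0.
Proof.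
rewrite ler_normr /bump /flat => /orP[t1|t1].
  by rewrite [X in _ * X]ifF ?mulr0 //; apply/negP; lra.
by rewrite ifF ?mul0r //; apply/negP; lra.
Qed.

(** [H] is the primitive of [bump], normalized to rise from 0 to 1. The bound [M] matters because
    the kernel [rho] rescaled to width [e] is then at most [M / e], which is what an estimate at
    Lebesgue points needs. *)
Lemma smooth_step : exists H rho M,
  [/\ forall n, nderivable n H, continuous rho, forall t, is_derive t 1 H (rho t) &
  [/\ forall t, 0 <= rho t <= M, forall t, 1 <= `|t| -> rho t = 0,
      forall t, t <= -1 -> H t = 0, forall t, 1 <= t -> H t = 1 &
      forall t, 0 <= H t <= 1]].
Proof.
have cb := nderivable_continuous nderivable_bump.
have lb := locint_continuous cb.
pose P := primitive bump; have pP : prim P bump by exact: prim_primitive.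
pose c := P 1 - P (-1).
have c0 : 0 < c.
  have h1 : (- 2^-1 : R) <= 2^-1 by lra.
  have [m /itvP mh mP] := EVT_min h1 (continuous_subspaceT cb).
  have m1 : -1 < m < 1.
    by have [] : - 2^-1 <= m /\ m <= 2^-1; [rewrite !mh|lra].
  apply: lt_le_trans (bump_gt0 m1) _.
  rewrite /c pP.2; last by lra.
  apply: (@le_trans _ _ (itg bump (- 2^-1) 2^-1)).
    apply: (@le_trans _ _ (itg (fun=> bump m) (- 2^-1) 2^-1)).
      by rewrite itg_cst // (_ : 2^-1 - _ = 1) ?mulr1 //; lra.
    by apply: (itg_le (locint_cst _) lb) => t tI; apply: mP; rewrite in_itv.
  by apply: (itg_sub lb); [exact: bump_ge0|lra..].
have [M M0 HM] := continuous_bounded_itv (-1) 1 cb.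
have out a b : a <= b -> (forall t, a <= t <= b -> 1 <= `|t|) -> P b - P a = 0.
  move=> ab o; rewrite pP.2 // -[RHS](mul0r (b - a)) -(itg_cst 0 ab).
  by apply: eq_Rintegral => t; rewrite inE /= in_itv /= => /o /bump_out.
have mono a b : a <= b -> P a <= P b.
  by move=> ab; rewrite -subr_ge0 pP.2 // itg_ge0 //; exact: bump_ge0.
pose H t := c^-1 * (P t + - P (-1)).
have Hlow t : t <= -1 -> H t = 0.
  move=> t1; have : P (-1) - P t = 0.
    by apply: out => // s /andP[_ s1]; rewrite ler_normr; apply/orP; right; lra.
  by move=> /subr0_eq E; rewrite /H E subrr mulr0.
have Hhigh t : 1 <= t -> H t = 1.
  move=> t1; have : P t - P 1 = 0.
    by apply: out => // s /andP[s1 _]; rewrite ler_normr s1.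
  by move=> /subr0_eq E; rewrite /H E mulVf // gt_eqF.
have dH t : is_derive t 1 H (c^-1 * bump t).
  have dP := prim_is_derive t pP cb.
  have h : is_derive t 1 (P + cst (- P (-1))) (bump t + 0) by exact: is_deriveD.
  rewrite addr0 in h.
  exact: (@is_deriveZ _ _ _ (P + cst (- P (-1))) c^-1).
exists H, (fun t => c^-1 * bump t), (c^-1 * M); split=> //.
- case=> [//|n]; apply: nderivable_intro dH _.
  by apply: nderivableM; [exact: nderivable_cst|exact: nderivable_bump].
- by move=> t; apply: cvgM; [exact: cvg_cst|exact: cb].
split=> //.
- move=> t; have ic : 0 <= c^-1 by rewrite invr_ge0 ltW.
  rewrite mulr_ge0 ?bump_ge0 //= ler_wpM2l //.
  have [t1|/bump_out-> //] := ltP `|t| 1.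
  apply: le_trans (ler_norm _) (HM t _).
  by move: t1; rewrite ltr_norml; lra.
- by move=> t /bump_out->; rewrite mulr0.
move=> t; have [t1|t1] := leP t (-1); first by rewrite Hlow // lexx ler01.
have [t2|t2] := leP 1 t; first by rewrite Hhigh // lexx ler01.
have Pt0 : P (-1) <= P t by apply: mono; exact: ltW.
have Pt1 : P t <= P 1 by apply: mono; exact: ltW.
apply/andP; split; first by rewrite mulr_ge0 ?subr_ge0 // invr_ge0 ltW.
by rewrite ler_pdivrMl // mulr1 lerD2r.
Qed.

End SmoothStep.

(** * Absolutely continuous representatives of weakly derivable functions *)

Section WeakDerivative.
Context {R : realType}.
Local Notation mu := (@lebesgue_measure R).
Implicit Types (f g F H rho phi : R -> R) (a b e s t M : R) (n : nat).

Lemma itg_zero f a b : (forall t, a <= t <= b -> f t = 0) -> itg f a b = 0.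
Proof.
move=> f0; rewrite /itg /Rintegral integral0_eq // => t /=.
by rewrite in_itv /= => /f0 ->.
Qed.

Lemma itg_supp f a b c d : locint f -> a <= b -> b <= c -> c <= d ->
  (forall t, a <= t <= b -> f t = 0) -> (forall t, c <= t <= d -> f t = 0) ->
  itg f a d = itg f b c.
Proof.
move=> lf ab bc cd f1 f2.
rewrite (itg_split lf ab (le_trans bc cd)) (itg_split lf bc cd).
by rewrite (itg_zero f1) (itg_zero f2) add0r addr0.
Qed.

Lemma Rintegral_supp f a b : (forall t, ~ (a <= t <= b) -> f t = 0) ->
  \int[mu]_(t in [set: R]) f t = itg f a b.
Proof.
move=> f0; rewrite /itg [RHS]Rintegral_mkcond; apply: eq_Rintegral => t _.
rewrite patchE; case: ifPn => //; rewrite notin_setE /= in_itv /= => H.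
exact: f0.
Qed.

Lemma lebesgue_pt_small f t e : locint f -> lebesgue_pt f t -> 0 < e ->
  exists2 d, 0 < d & forall r, 0 < r -> r < d ->
    itg (fun s => `|f s - f t|) (t - r) (t + r) <= e * r.
Proof.
move=> lf ft e0.
(* The mean is taken over an interval of length [2 r], so [e / 2] for the mean is [e * r] for the
   integral. *)
have N : nbhs (0%E : \bar R) [set y | (y < (e / 2)%:E)%E].
  apply: open_nbhs_nbhs; split; first exact: open_ereal_lt_ereal.
  by rewrite /= lte_fin; lra.
have [d /= d0 dP] := ft _ N; exists d => // r r0 rd.
have := dP r; rewrite /ball_ /= sub0r normrN gtr0_norm // => /(_ rd r0).
have lfa : locint (fun s => `|f s - f t|) by apply/locint_abs/locintB/locint_cst.
rewrite /davg /iavg (lebesgue_measure_ball _ (ltW r0)) inver ifF; last by apply/negP => /eqP; lra.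
have -> : (\int[mu]_(y in ball t r) `|((center (f t) \o f) y)%:E| =
    (itg (fun s => `|f s - f t|) (t - r) (t + r))%:E)%E.
  have mE D : measurable_fun D (fun y => `|((center (f t) \o f) y)%:E|%E).
    by apply: measurable_funTS; apply/measurable_EFinP; exact: lfa.1.
  rewrite ball_itv integral_itv_bndo_bndc;last exact: mE.
  rewrite integral_itv_obnd_cbnd;last exact: mE.
  rewrite /itg /Rintegral fineK //; apply: integrable_fin_num => //.
  exact: lfa.2.
rewrite -EFinM lte_fin mulrC ltr_pdivrMr; last by lra.
by move=> /ltW; lra.
Qed.

Section WeakPrimitive.
Variables (f g : R -> R).
Hypotheses (lf : locint f) (lg : locint g).
Hypothesis weak : forall phi, test_function phi ->
  \int[mu]_(t in [set: R]) (f t * derive1 phi t) =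
  - \int[mu]_(t in [set: R]) (g t * phi t).

Variables (H rho : R -> R) (M : R).
Hypothesis nH : forall n, nderivable n H.
Hypothesis crho : continuous rho.
Hypothesis dH : forall t, is_derive t 1 H (rho t).
Hypothesis rhoM : forall t, 0 <= rho t <= M.
Hypothesis rho_out : forall t, 1 <= `|t| -> rho t = 0.
Hypothesis Hlow : forall t, t <= -1 -> H t = 0.
Hypothesis Hhigh : forall t, 1 <= t -> H t = 1.
Hypothesis H01 : forall t, 0 <= H t <= 1.

Let arg e a t := e^-1 * t + - (e^-1 * a).
Let step e a t := H (arg e a t).
Let kern e a t := e^-1 * rho (arg e a t).

Let argE e a t : arg e a t = (t - a) / e.
Proof. by rewrite /arg -mulrBr mulrC. Qed.

Let step_low e a t : 0 < e -> t <= a - e -> step e a t = 0.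
Proof. by move=> e0 ta; apply: Hlow; rewrite argE ler_pdivrMr //; lra. Qed.

Let step_high e a t : 0 < e -> a + e <= t -> step e a t = 1.
Proof. by move=> e0 ta; apply: Hhigh; rewrite argE ler_pdivlMr //; lra. Qed.

Let kern_out e a t : 0 < e -> e <= `|t - a| -> kern e a t = 0.
Proof.
move=> e0 ta; rewrite /kern rho_out ?mulr0 // argE normrM normfV (gtr0_norm e0).
by rewrite ler_pdivlMr // mul1r.
Qed.

Let step_derive e a t : is_derive t 1 (step e a) (kern e a t).
Proof. exact: is_derive_affine. Qed.

Let kern_continuous e a : continuous (kern e a).
Proof.
move=> t; apply: cvgM; first exact: cvg_cst.
apply: (@continuous_comp _ _ _ (arg e a) rho); last exact: crho.
apply: cvgD; last exact: cvg_cst.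
by apply: cvgM; [exact: cvg_cst|exact: cvg_id].
Qed.

Let cutoff e a b t := step e a t + -1 * step e b t.

Let cutoff_test e a b : 0 < e -> a <= b -> test_function (cutoff e a b).
Proof.
move=> e0 ab; split.
  apply: nderivable_derivable => n; apply: nderivableD; first exact: nderivable_affine.
  by apply: nderivableM; [exact: nderivable_cst|exact: nderivable_affine].
apply: (subclosed_compact _ (@segment_compact _ (a - e) (b + e))).
  exact: closed_closure.
have /closure_subset : [set t | cutoff e a b t != 0] `<=` `[a - e, b + e].
  move=> t /=; rewrite in_itv /=; apply: contraNT => nt; apply/eqP.
  have [t1|t1] := leP (a - e) t; last first.
    by rewrite /cutoff !step_low ?mulr0 ?addr0 //; lra.
  have [t2|t2] := leP t (b + e); first by move: nt; rewrite t1 t2.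
  by rewrite /cutoff !step_high //; lra.
by have /closure_id <- : closed `[a - e, b + e]%classic by exact: itv_closed.
Qed.

Let cutoff_derive e a b t : derive1 (cutoff e a b) t = kern e a t - kern e b t.
Proof.
rewrite derive1E.
have h2 : is_derive t 1 (-1 \*: (step e b : R -> R^o)) (-1 *: (kern e b t : R^o)).
  by apply: is_deriveZ; exact: step_derive.
have h := is_deriveD (step_derive e a t) h2.
by rewrite -[RHS]/(kern e a t + _) -mulN1r; exact: derive_val.
Qed.

Let kern_itg e a : 0 < e -> itg (kern e a) (a - e) (a + e) = 1.
Proof.
move=> e0.
have [_ <-] := prim_of_derive (step_derive e a) (@kern_continuous e a); last by lra.
by rewrite step_high // step_low // subr0.
Qed.

(** As the kernel has integral 1, [f a] can be moved under the integral; then the kernel is bounded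
    by [M / e]. At a Lebesgue point the right-hand side tends to 0 with [e]. *)
Let kern_approx e a : 0 < e ->
  `|itg (fun t => kern e a t * f t) (a - e) (a + e) - f a| <=
  M / e * itg (fun t => `|f t - f a|) (a - e) (a + e).
Proof.
move=> e0; have lk := locintMc (@kern_continuous e a) lf.
have lc := locintZ (f a) (locint_continuous (@kern_continuous e a)).
have lfa := locintB lf (locint_cst (f a)).
have -> : itg (fun t => kern e a t * f t) (a - e) (a + e) - f a =
    itg (fun t => kern e a t * (f t - f a)) (a - e) (a + e).
  rewrite -{1}[f a]mulr1 -(kern_itg a e0) -itgZ; last exact: locint_continuous.
  by rewrite -itgB //; congr itg; apply/funext => t; ring.
apply: le_trans (itg_abs _ _ (locintMc (@kern_continuous e a) lfa)) _.
rewrite -itgZ; last exact: locint_abs.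
apply: itg_le; [exact/locint_abs/locintMc|exact/locintZ/locint_abs|].
have ie0 : 0 <= e^-1 by rewrite invr_ge0 ltW.
move=> t _; have /andP[r0 rM] := rhoM (arg e a t).
rewrite normrM; apply: ler_wpM2r => //.
by rewrite /kern normrM !ger0_norm // mulrC; apply: ler_wpM2r.
Qed.

(** The cutoff is 1 on [[a + e, b - e]], so the error lives in two windows of width [2 e] around the
    end points. *)
Let cutoff_approx e a b : 0 < e -> a + e <= b - e ->
  `|itg (fun t => cutoff e a b t * g t) (a - e) (b + e) - itg g a b| <=
  itg (fun t => `|g t|) (a - e) (a + e) + itg (fun t => `|g t|) (b - e) (b + e).
Proof.
move=> e0 ab.
have cc : continuous (cutoff e a b).
  by apply: nderivable_continuous => n; apply: nderivableD; [exact: nderivable_affine|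
    apply: nderivableM; [exact: nderivable_cst|exact: nderivable_affine]].
have lc := locintMc cc lg; have la := locint_abs lg; have lca := locint_abs lc.
have ld := locintB lc lg; have lda := locint_abs ld.
(* Since [a + e <= b - e], at every point one of the two steps is constant: the one at [a] is
   already 1, or the one at [b] is still 0. *)
have c01 t : 0 <= cutoff e a b t <= 1.
  rewrite /cutoff; have /andP[p1 p2] := H01 (arg e a t).
  have /andP[p3 p4] := H01 (arg e b t).
  have [ta|ta] := leP (b - e) t.
    by rewrite (@step_high e a); [rewrite /step; lra|lra|lra].
  by rewrite (@step_low e b); [rewrite /step; lra|lra|lra].
have le1 s t : s <= t ->
    `|itg (fun t => cutoff e a b t * g t) s t| <= itg (fun t => `|g t|) s t.
  move=> st; apply: le_trans (itg_abs _ _ lc) _; apply: itg_le => // r _.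
  have /andP[c0 c1] := c01 r.
  by rewrite normrM ger0_norm // ler_piMl.
have le2 s t : s <= t ->
    `|itg (fun t => cutoff e a b t * g t) s t - itg g s t| <= itg (fun t => `|g t|) s t.
  move=> st; rewrite -itgB //; apply: le_trans (itg_abs _ _ ld) _; apply: itg_le => // r _.
  have /andP[c0 c1] := c01 r.
  rewrite -{2}[g r]mul1r -mulrBl normrM ler_piMl // ler_norml; lra.
have eq0 : itg (fun t => cutoff e a b t * g t) (a + e) (b - e) = itg g (a + e) (b - e).
  apply: eq_Rintegral => t; rewrite inE /= in_itv /= => /andP[t1 t2].
  by rewrite /cutoff step_high // step_low // mulr0 addr0 mul1r.
have [h1 h2 h3] : [/\ a - e <= a, a <= a + e & b - e <= b] by split; lra.
have h4 : b <= b + e by lra.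
have hab : a <= b by lra.
rewrite (itg_split lc h1 (le_trans hab h4)) (itg_split lc hab h4).
rewrite (itg_split lc h2 (le_trans ab h3)) (itg_split lc ab h3).
rewrite (itg_split lg h2 (le_trans ab h3)) (itg_split lg ab h3) eq0.
rewrite (itg_split la h1 h2) (itg_split la h3 h4).
move: (le1 _ _ h1) (le2 _ _ h2) (le2 _ _ h3) (le1 _ _ h4).
rewrite !ler_norml; lra.
Qed.

(* The test functions [cutoff] are smoothed indicators of [a, b], and their
   derivatives are approximate identities at [a] and at [b]. *)
Lemma weak_prim_lebesgue a b : a < b -> lebesgue_pt f a -> lebesgue_pt f b ->
  f b - f a = itg g a b.
Proof.
move=> ab fa fb; apply/eqP; rewrite -subr_eq0 -normr_le0.
apply/ler_addgt0Pr => e e0; rewrite add0r.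
have M0 : 0 <= M by have /andP[r0 /(le_trans r0)] := rhoM 0.
(* Four errors share [e]: one kernel and one window of [g] at each end point. [M + 1] is used
   because only [M >= 0] is known. *)
have eM : 0 < e / (4 * (M + 1)) by rewrite divr_gt0 //; lra.
have [d1 d10 d1P] := lebesgue_pt_small lf fa eM.
have [d2 d20 d2P] := lebesgue_pt_small lf fb eM.
have e4 : 0 < e / 4 by lra.
have [d3 d30 d3P] := itg_small (a - 1) (b + 1) lg e4.
(* The windows have length [2 r]: they must be short for [g], stay inside [[a - 1, b + 1]] and not
   overlap. *)
have [r [r0 [rd1 rd2] [rd3 r1 rab]]] : exists r, [/\ 0 < r, r < d1 /\ r < d2 &
    [/\ 2 * r < d3, r < 1 & 2 * r < b - a]].
  pose m := Num.min (Num.min d1 d2) (Num.min d3 (Num.min 1 (b - a))).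
  have m0 : 0 < m by rewrite !lt_min d10 d20 d30 ltr01 subr_gt0.
  have := lexx m; rewrite {2}/m !le_min => /andP[/andP[h1 h2]] /and3P[h3 h4 h5].
  by exists (m / 3); split; [|split|split]; lra.
have G1 : itg (fun t => `|g t|) (a - r) (a + r) < e / 4 by apply: d3P; lra.
have G2 : itg (fun t => `|g t|) (b - r) (b + r) < e / 4 by apply: d3P; lra.
have ab' : a + r <= b - r by lra.
have Ka := kern_approx a r0; have Kb := kern_approx b r0.
have C := cutoff_approx r0 ab'.
have := weak (cutoff_test r0 (ltW ab)).
have -> : \int[mu]_(t in [set: R]) (f t * derive1 (cutoff r a b) t) =
    itg (fun t => kern r a t * f t) (a - r) (a + r) -
    itg (fun t => kern r b t * f t) (b - r) (b + r).
  have l1 := locintMc (@kern_continuous r a) lf; have l2 := locintMc (@kern_continuous r b) lf.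
  rewrite (@Rintegral_supp _ (a - r) (b + r)); last first.
    move=> t nt; rewrite cutoff_derive !kern_out ?subr0 ?mulr0 //.
      rewrite ler_normr; have [t1|t1] := leP (b + r) t; apply/orP; [left|right]; first by lra.
      have [t2|t2] := leP (a - r) t; last by lra.
      by case: nt; rewrite t2 ltW.
    rewrite ler_normr; have [t1|t1] := leP (b + r) t; apply/orP; [left|right]; first by lra.
    have [t2|t2] := leP (a - r) t; last by lra.
    by case: nt; rewrite t2 ltW.
  have -> : (fun t => f t * derive1 (cutoff r a b) t) =
      (fun t => kern r a t * f t - kern r b t * f t).
    by apply/funext => t; rewrite cutoff_derive; ring.
  rewrite itgB //; congr (_ - _).
    rewrite (@itg_supp _ (a - r) (a - r) (a + r)) //; try lra.
      by move=> t /andP[t1 t2]; rewrite kern_out ?mul0r // ler_normr; apply/orP; right; lra.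
    by move=> t /andP[t1 t2]; rewrite kern_out ?mul0r // ler_normr; apply/orP; left; lra.
  rewrite (@itg_supp _ (a - r) (b - r) (b + r)) //; try lra.
    by move=> t /andP[t1 t2]; rewrite kern_out ?mul0r // ler_normr; apply/orP; right; lra.
  by move=> t /andP[t1 t2]; rewrite kern_out ?mul0r // ler_normr; apply/orP; left; lra.
rewrite (@Rintegral_supp _ (a - r) (b + r)); last first.
  move=> t nt; have [t1|t1] := leP (a - r) t; last first.
    by rewrite /cutoff !step_low ?mulr0 ?addr0 ?mulr0 //; lra.
  have [t2|t2] := leP t (b + r); first by case: nt; rewrite t1 t2.
  by rewrite /cutoff !step_high ?mulr1 ?subrr ?mulr0 //; lra.
have -> : (fun t => g t * cutoff r a b t) = (fun t => cutoff r a b t * g t).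
  by apply/funext => t; rewrite mulrC.
have bnd x d : (forall r, 0 < r -> r < d -> itg (fun s => `|f s - f x|) (x - r) (x + r) <=
    e / (4 * (M + 1)) * r) -> r < d ->
    M / r * itg (fun s => `|f s - f x|) (x - r) (x + r) <= e / 4.
  move=> dP rd; have h : 0 <= M / r by rewrite divr_ge0 // ltW.
  apply: le_trans (ler_wpM2l h (dP r r0 rd)) _.
  have -> : M / r * (e / (4 * (M + 1)) * r) = (e / 4) * (M / (M + 1)).
    by field; rewrite !gt_eqF //; lra.
  by rewrite ler_piMr ?ltW // ltr_pdivrMr; lra.
have B1 := bnd a d1 d1P rd1; have B2 := bnd b d2 d2P rd2.
move: Ka Kb C B1 B2 G1 G2; rewrite !ler_norml => Ka Kb C B1 B2 G1 G2 E.
lra.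
Qed.

End WeakPrimitive.

(** This is the du Bois-Reymond lemma. Between Lebesgue points of [f] the increments are integrals
    of [g]; as almost every point is one, [f] agrees almost everywhere with the primitive of [g]
    anchored at a single Lebesgue point [a0]. *)
Lemma weak_prim f g : locally_integrable [set: R] f ->
  locally_integrable [set: R] g ->
  (forall phi, test_function phi ->
    \int[mu]_(t in [set: R]) (f t * derive1 phi t) =
    - \int[mu]_(t in [set: R]) (g t * phi t)) ->
  exists2 F, prim F g & ae_eq mu [set: R] f F.
Proof.
move=> locf locg weak; have lf := locint_locally locf; have lg := locint_locally locg.
have [H [rho [M [nH crho dH [rhoM rho_out Hlow Hhigh H01]]]]] := @smooth_step R.
have key a b : a < b -> lebesgue_pt f a -> lebesgue_pt f b -> f b - f a = itg g a b.
  exact: (weak_prim_lebesgue lf lg weak nH crho dH rhoM rho_out Hlow Hhigh H01).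
have aeL := lebesgue_differentiation locf.
(* Otherwise the null set of exceptional points would contain [[0, 1]]. *)
have [a0 fa0] : exists a0, lebesgue_pt f a0.
  apply: contrapT => /forallNP nL; have [A [mA A0 sA]] := aeL.
  have AT : A = [set: R].
    by apply/seteqP; split=> // t _; apply: sA => /=; exact: nL.
  have : (mu `[0%R, 1%R]%classic <= mu A)%E.
    by apply: le_measure; rewrite ?inE // AT.
  by rewrite A0 lebesgue_measure_itv /= lte_fin ltr01 oppr0 adde0 lee_fin ler10.
have pP := prim_primitive lg.
exists (fun t => primitive g t + (f a0 - primitive g a0)).
  split=> // a b ab; rewrite -(pP.2 _ _ ab); ring.
move: aeL; apply: filterS; first exact: (ae_filter_ringOfSetsType mu).
move=> b fb _.
have [ab|ab|->] := ltgtP a0 b; last by ring.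
- by have := key _ _ ab fa0 fb; rewrite -pP.2 ?ltW // => E; lra.
- by have := key _ _ ab fb fa0; rewrite -pP.2 ?ltW // => E; lra.
Qed.

End WeakDerivative.

(** * Decay at infinity *)

Section Decay.
Context {R : realType}.
Local Notation mu := (@lebesgue_measure R).
Implicit Types (f g h F x w p q l sigma tau : R -> R) (a b e s t M S T : R).

Definition integrableT f := mu.-integrable [set: R] (EFin \o f).

Definition vanishes f := forall e, 0 < e -> exists M, forall t, M <= `|t| -> `|f t| <= e.

Lemma itg_le_total f a b : (forall t, 0 <= f t) -> integrableT f ->
  itg f a b <= \int[mu]_(t in [set: R]) f t.
Proof.
move=> f0 If; rewrite /itg /Rintegral fine_le //.
- by apply: integrable_fin_num => //; exact: integrableS If.
- exact: integrable_fin_num.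
apply: ge0_subset_integral => //; first exact: (measurable_int mu If).
by move=> t _; rewrite lee_fin.
Qed.

Lemma itg_tail f e : (forall t, 0 <= f t) -> integrableT f -> 0 < e ->
  exists M, forall t, M <= `|t| -> itg f t (t + 1) <= e.
Proof.
move=> f0 If e0; have lf := locint_integrable If.
set J := \int[mu]_(t in [set: R]) f t.
have [n nP] : exists n : nat, J - e < itg f (- n%:R) n%:R.
  have ndF : nondecreasing_seq (fun n : nat => `[- (n%:R : R), n%:R]%classic).
    move=> m n mn; apply/subsetPset => t /=; rewrite !in_itv /= => /andP[t1 t2].
    have : (m%:R : R) <= n%:R by rewrite ler_nat.
    by move=> h; apply/andP; split; lra.
  have UT : \bigcup_n `[- (n%:R : R), n%:R]%classic = [set: R].
    apply/seteqP; split=> // t _; exists (Num.bound t) => //=; rewrite in_itv /=.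
    by rewrite -ler_norml ltW //; have := archi_boundP (normr_ge0 t); rewrite /Num.bound normr_id.
  have cv := @ge0_nondecreasing_set_cvg_integral _ (measurableTypeR R) R _ (EFin \o f) mu ndF
    (fun n => measurable_itv _)
    (fun n => measurable_funTS (measurable_int mu If)) (fun n t _ => f0 t).
  rewrite UT in cv.
  have JE : (\int[mu]_(x in [set: R]) (EFin \o f) x)%E = J%:E.
    by rewrite /J /Rintegral fineK //; exact: integrable_fin_num.
  rewrite JE in cv.
  have N : nbhs (J%:E : \bar R) [set y | ((J - e)%:E < y)%E].
    apply: open_nbhs_nbhs; split; first exact: open_ereal_gt_ereal.
    by rewrite /= lte_fin; lra.
  have [n _ nP] := cv _ N; exists n.
  have := nP n (leqnn n); rewrite /= -lte_fin => /lt_le_trans; apply.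
  by rewrite /itg /Rintegral fineK //; apply: integrable_fin_num => //; exact: integrableS If.
(* For negative [t] the window [[t, t + 1]] reaches one unit towards the origin; the [+ 1] keeps it
   outside [[- n, n]]. *)
exists (n%:R + 1) => t tn.
have [t0|t0] := leP 0 t.
  have nt : n%:R <= t by move: tn; rewrite ger0_norm //; lra.
  have h := itg_le_total (- n%:R) (t + 1) f0 If.
  have n0 : (0 : R) <= n%:R by [].
  have h2 : itg f (- n%:R) (t + 1) = itg f (- n%:R) n%:R + itg f n%:R (t + 1).
    by apply: itg_split => //; lra.
  have h3 : itg f t (t + 1) <= itg f n%:R (t + 1) by apply: itg_sub => //; lra.
  by rewrite -/J in h; lra.
have nt : t + 1 <= - n%:R by move: tn; rewrite ltr0_norm //; lra.
have h := itg_le_total t n%:R f0 If.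
have n0 : (0 : R) <= n%:R by [].
have h2 : itg f t n%:R = itg f t (- n%:R) + itg f (- n%:R) n%:R.
  by apply: itg_split => //; lra.
have h3 : itg f t (t + 1) <= itg f t (- n%:R) by apply: itg_sub => //; lra.
by rewrite -/J in h; lra.
Qed.

Lemma prim_le_avg F f t : prim F f ->
  `|F t| <= itg (fun s => `|F s|) t (t + 1) + itg (fun s => `|f s|) t (t + 1).
Proof.
move=> pF; have [lf _] := pF; have la := locint_abs lf.
have lF := locint_continuous (prim_continuous pF); have lFa := locint_abs lF.
have t1 : t <= t + 1 by lra.
set k := itg (fun s => `|f s|) t (t + 1).
have -> : `|F t| = itg (fun=> `|F t|) t (t + 1) by rewrite itg_cst // addrAC subrr add0r mulr1.
have -> : k = itg (fun=> k) t (t + 1) by rewrite itg_cst // addrAC subrr add0r mulr1.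
rewrite -itgD //; last exact: locint_cst.
apply: itg_le; [exact: locint_cst|by apply: locintD => //; exact: locint_cst|].
move=> s /andP[ts st].
have h := prim_dist pF ts.
have h1 : itg (fun r => `|f r|) t s <= k by apply: itg_sub => //; lra.
have := ler_normB (F s) (F s - F t); rewrite opprB addrC subrK; lra.
Qed.

(** [prim_le_avg] is applied to [x ^ 2] rather than [x]: [x ^ 2 + |2 x w|] is at most
    [2 x ^ 2 + w ^ 2], an integrable function, whose integrals over unit windows tend to 0. *)
Lemma vanishes_prim_L2 x w : prim x w -> integrableT (fun t => x t ^+ 2) ->
  integrableT (fun t => w t ^+ 2) -> vanishes x.
Proof.
move=> px Ix Iw e e0.
have pxx := primM px px.
have I : integrableT (fun t => 2 * x t ^+ 2 + w t ^+ 2).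
  exact: (integrableD measurableT (integrableZl measurableT 2 Ix) Iw).
have [M MP] := itg_tail (fun t => addr_ge0 (mulr_ge0 (ler0n _ 2) (sqr_ge0 (x t))) (sqr_ge0 (w t))) I (exprn_gt0 2 e0).
exists M => t /MP H.
rewrite -ler_sqr ?nnegrE ?(ltW e0) // real_normK ?num_real //.
apply: le_trans H; apply: le_trans (ler_norm _) _; rewrite expr2.
apply: le_trans (prim_le_avg t pxx) _.
have lxx := locint_continuous (prim_continuous pxx).
rewrite -itgD; [|exact: locint_abs|exact/locint_abs/pxx.1].
apply: itg_le; [|exact: locint_integrable|].
  by apply: locintD; [exact: locint_abs|exact/locint_abs/pxx.1].
move=> s _; rewrite ger0_norm -?expr2 ?sqr_ge0 //.
have h1 := sqr_ge0 (x s + w s); have h2 := sqr_ge0 (x s - w s).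
have : `|x s * w s + x s * w s| <= x s ^+ 2 + w s ^+ 2.
  by rewrite ler_norml; apply/andP; split; nra.
by lra.
Qed.

End Decay.

(** * Gordon's argument for the real system *)

Section QuasiSystem.
Context {R : realType}.
Local Notation mu := (@lebesgue_measure R).
Implicit Types (f g h F x w p q l v rho : R -> R) (a b e s t M T : R).

Lemma vanishes_bounded F : continuous F -> vanishes F ->
  exists2 K, 0 <= K & forall t, `|F t| <= K.
Proof.
move=> cF vF; have [M MP] := vF 1 ltr01.
have [K K0 KP] := continuous_bounded_itv (- M) M cF.
exists (K + 1); first by lra.
move=> t; have [tM|tM] := leP M `|t|; first by have := MP t tM; lra.
have : `|F t| <= K by apply: KP; rewrite -ler_norml ltW.
by lra.
Qed.

(** An interval of length [T] is covered by [truncn T + 1] unit windows, hence the bound with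
    [T + 1]. *)
Lemma itg_unif f S a T : locint f -> (forall t, 0 <= f t) ->
  (forall t, itg f t (t + 1) <= S) -> 0 <= T -> itg f a (a + T) <= S * (T + 1).
Proof.
move=> lf f0 fS T0.
have step n : itg f a (a + n%:R) <= n%:R * S.
  elim: n => [|n IH]; first by rewrite addr0 itgxx mul0r.
  have n0 : (0 : R) <= n%:R by [].
  rewrite -natr1 addrA (@itg_split _ f a (a + n%:R)) //; [|by lra..].
  by have := fS (a + n%:R); rewrite mulrDl mul1r; lra.
have S0 : 0 <= S by apply: le_trans (fS 0); exact: itg_ge0.
have nT := truncnS_gt T; have Tn := truncn_le T; rewrite T0 in Tn.
apply: (@le_trans _ _ (itg f a (a + (Num.truncn T).+1%:R))).
  by apply: itg_sub => //; lra.
apply: le_trans (step _) _; rewrite mulrC ler_wpM2l // -natr1 lerD2r.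
by case/truncn_itv/andP: T0.
Qed.

Variables (sigma tau : R -> R) (S : R).
Hypothesis msigma : measurable_fun [set: R] sigma.
Hypothesis lsigma2 : locint (fun t => sigma t ^+ 2).
Hypothesis ltau : locint tau.
Hypothesis sigmaS : forall t, itg (fun s => sigma s ^+ 2) t (t + 1) <= S.
Hypothesis tauS : forall t, itg (fun s => `|tau s|) t (t + 1) <= S.

Let S0 : 0 <= S.
Proof. by apply: le_trans (sigmaS 0); apply: itg_ge0 => t; exact: sqr_ge0. Qed.

(** The delicate term of [p'] is [sigma * w]. With a weight [d], it is split into [d * sigma ^ 2],
    small by the uniform bound [S], and [w ^ 2 / d], small by the tail of [w ^ 2]. The inhomogeneity
    [l] carries the eigenvalue: decay is needed while the eigenvalue may still be complex and
    couples the real and imaginary parts. *)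
Lemma vanishes_quasi x p l :
  prim x (fun t => sigma t * x t + p t) ->
  prim p (fun t => - sigma t * (sigma t * x t + p t) + tau t * x t - l t) ->
  integrableT (fun t => (sigma t * x t + p t) ^+ 2) ->
  vanishes x -> vanishes l -> vanishes p.
Proof.
set w := fun t => sigma t * x t + p t => px pp Iw vx vl e e0.
have S1 : 0 < S + 1 by have := S0; lra.
(* Three shares of [e / 4]: [d (1 + S)], the tail bound [d e / 2] divided by [2 d], and
   [n (2 + 2 S)]. *)
pose d := e / (4 * (S + 1)); have d0 : 0 < d by rewrite divr_gt0 //; lra.
pose n := e / (8 * (S + 1)); have n0 : 0 < n by rewrite divr_gt0 //; lra.
have d20 : 0 < d * e / 2 by rewrite divr_gt0 // mulr_gt0.
have [M1 MP1] := itg_tail (fun t => sqr_ge0 (w t)) Iw d20.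
have [M2 MP2] := vx n n0; have [M3 MP3] := vl n n0.
(* [x] and [l] must be small on all of [[t, t + 1]], where [|s|] can fall to [|t| - 1]. *)
exists (Num.max M1 (Num.max M2 M3 + 1)) => t; rewrite ge_max => /andP[t1].
rewrite -lerBrDr ge_max => /andP[t2 t3].
have lw2 := locint_integrable Iw.
have lpa := locint_abs (locint_continuous (prim_continuous pp)).
have lqa := locint_abs pp.1.
apply: le_trans (prim_le_avg t pp) _; rewrite -itgD //.
have arith (I1 I2 I3 : R) : I1 <= d * e / 2 -> I3 <= S -> I2 <= S ->
    d * (1 + I3) + ((2 * d)^-1 * I1 + n * (2 + I3 + I2)) <= e.
  move=> H1 H3 H2.
  have S1n : S + 1 != 0 by rewrite gt_eqF.
  have Ed : d * (S + 1) = e / 4 by rewrite /d; field.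
  have En : n * (2 * (S + 1)) = e / 4 by rewrite /n; field.
  have G1 : d * (1 + I3) <= d * (S + 1) by apply: ler_wpM2l; [exact: ltW|lra].
  have G2 : (2 * d)^-1 * I1 <= e / 4 by rewrite ler_pdivrMl; lra.
  have G3 : n * (2 + I3 + I2) <= n * (2 * (S + 1)).
    by apply: ler_wpM2l; [exact: ltW|lra].
  by move: G1 G2 G3; rewrite Ed En; lra.
pose dom s := d * (1 + sigma s ^+ 2) + ((2 * d)^-1 * w s ^+ 2 +
  n * (2 + sigma s ^+ 2 + `|tau s|)).
have l1 : locint (fun s => 1 + sigma s ^+ 2) by apply: locintD => //; exact: locint_cst.
have l2 : locint (fun s => 2 + sigma s ^+ 2 + `|tau s|).
  by apply: locintD; [apply: locintD => //; exact: locint_cst|exact: locint_abs].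
have ldom : locint dom by apply: locintD; [exact: locintZ|apply: locintD; exact: locintZ].
have tt : t <= t + 1 by lra.
apply: (@le_trans _ _ (itg dom t (t + 1))).
  apply: itg_le => //; first exact: locintD.
  move=> s /andP[ts st].
  have sge : `|t| - 1 <= `|s|.
    have := ler_normB s (s - t); rewrite opprB addrC subrK.
    by rewrite (ger0_norm (_ : 0 <= s - t)); lra.
  have xs := MP2 s (le_trans t2 sge); have ls := MP3 s (le_trans t3 sge).
  have E : p s = w s - sigma s * x s by rewrite /w addrAC subrr add0r.
  have A1 : `|p s| <= `|w s| + `|sigma s| * `|x s|.
    by rewrite E -normrM ler_normB.
  have A2 : `|- sigma s * w s + tau s * x s - l s| <=
      `|sigma s| * `|w s| + `|tau s| * `|x s| + `|l s|.
    apply: le_trans (ler_normB _ _) _; rewrite lerD2r.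
    by apply: le_trans (ler_normD _ _) _; rewrite !normrM normrN.
  apply: le_trans (lerD A1 A2) _; rewrite /dom.
  have Ew : w s ^+ 2 = `|w s| ^+ 2 by rewrite real_normK ?num_real.
  have Es : sigma s ^+ 2 = `|sigma s| ^+ 2 by rewrite real_normK ?num_real.
  rewrite Ew Es.
  move: (`|w s|) (`|sigma s|) (`|tau s|) (`|x s|) (`|l s|) (normr_ge0 (w s))
    (normr_ge0 (sigma s)) (normr_ge0 (tau s)) (normr_ge0 (x s)) xs ls.
  move=> W G Ta X L W0 G0 Ta0 X0 Xn Ln.
  have B1 : W * (1 + G) <= d * (1 + G ^+ 2) + (2 * d)^-1 * W ^+ 2.
    have i0 : 0 < (2 * d)^-1 by rewrite invr_gt0; lra.
    have H := mulr_ge0 (ltW i0) (sqr_ge0 (W - d * (1 + G))).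
    have E2 : (2 * d)^-1 * (W - d * (1 + G)) ^+ 2 =
      (2 * d)^-1 * W ^+ 2 - W * (1 + G) + d * (1 + G) ^+ 2 / 2.
      by field; rewrite gt_eqF.
    have H2 := mulr_ge0 (ltW d0) (sqr_ge0 (1 - G)).
    by rewrite E2 in H; move: H H2; rewrite !expr2; lra.
  have B2 : G * X + Ta * X + L <= n * (2 + G ^+ 2 + Ta).
    have C1 : (G + Ta) * X <= (G + Ta) * n by apply: ler_wpM2l => //; lra.
    have C2 := mulr_ge0 (ltW n0) (sqr_ge0 (1 - G)).
    have C3 := mulr_ge0 (ltW n0) (sqr_ge0 G).
    by move: C1 C2 C3; rewrite !expr2; lra.
  by move: B1 B2; lra.
rewrite /dom (itgD _ _ (locintZ d l1) (locintD (locintZ _ lw2) (locintZ n l2))).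
rewrite (itgD _ _ (locintZ _ lw2) (locintZ n l2)) !itgZ //.
rewrite (itgD _ _ (locintD (locint_cst 2) lsigma2) (locint_abs ltau)).
rewrite !(itgD _ _ (locint_cst _) lsigma2) !itg_cst //.
rewrite addrAC subrr add0r !mulr1.
exact: arith (MP1 t t1) (sigmaS t) (tauS t).
Qed.

(** A majorant of the norm of the coefficient matrix with rows [(sigma, 1)] and
    [(tau - sigma ^ 2, - sigma)]; [|sigma|] is replaced by squares so that [S] controls the
    integral. *)
Let al t := 2 + 2 * sigma t ^+ 2 + `|tau t|.

Let lal : locint al.
Proof.
apply: locintD; last exact: locint_abs.
by apply: locintD; [exact: locint_cst|exact: locintZ].
Qed.

Let al0 t : 0 <= al t.
Proof. by have := sqr_ge0 (sigma t); have := normr_ge0 (tau t); rewrite /al; lra. Qed.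

Let itg_al a b : a <= b -> itg al a b <= (2 + 3 * S) * (b - a + 1).
Proof.
move=> ab; have := @itg_unif al (2 + 3 * S) a (b - a) lal al0.
rewrite subrKC subr_ge0; apply=> // t.
 rewrite (itgD _ _ (locintD (locint_cst 2) (locintZ 2 lsigma2)) (locint_abs ltau)).
rewrite (itgD _ _ (locint_cst 2) (locintZ 2 lsigma2)) itgZ // itg_cst; last by lra.
by have := sigmaS t; have := tauS t; lra.
Qed.

(** An error [r1] in the first equation perturbs [v'], which recurs in the second one multiplied by
    [sigma]; this accounts for the weight [1 + |sigma|] in the hypothesis on [rho]. *)
Lemma quasi_gronwall v p (r1 r2 : R -> R) rho a b :
  prim v (fun t => sigma t * v t + p t + r1 t) ->
  prim p (fun t => - sigma t * (sigma t * v t + p t + r1 t) + tau t * v t + r2 t) ->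
  locint rho -> (forall t, `|r1 t| * (1 + `|sigma t|) + `|r2 t| <= rho t) -> a <= b ->
  let E := expR (2 * ((2 + 3 * S) * (b - a + 1))) in
  `|v b| + `|p b| <= (`|v a| + `|p a| + itg rho a b) * E /\
  `|v a| + `|p a| <= (`|v b| + `|p b| + itg rho a b) * E.
Proof.
move=> pv pp lrho rhoP ab E.
have rho0 t : 0 <= rho t.
  by apply: le_trans (rhoP t); rewrite addr_ge0 // mulr_ge0 // addr_ge0.
pose N t := `|v t| + `|p t|.
have cN : continuous N.
  move=> t; apply: cvgD; [apply: (@continuous_comp _ _ _ v (fun y => `|y|))|
    apply: (@continuous_comp _ _ _ p (fun y => `|y|))]; try exact: norm_continuous.
    exact: (prim_continuous pv).
  exact: (prim_continuous pp).
have N0 t : 0 <= N t by exact: addr_ge0.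
have lNal := locintMc cN lal.
have key s t : s <= t -> `|N t - N s| <= itg (fun r => N r * al r + rho r) s t.
  move=> st; have h1 := prim_dist pv st; have h2 := prim_dist pp st.
  have h3 := lerB_dist (v t) (v s); have h3' := lerB_dist (v s) (v t).
  have h4 := lerB_dist (p t) (p s); have h4' := lerB_dist (p s) (p t).
  have : `|N t - N s| <= `|v t - v s| + `|p t - p s|.
    rewrite ler_norml /N; rewrite distrC in h3'; rewrite distrC in h4'.
    by apply/andP; split; lra.
  move=> /le_trans; apply; apply: le_trans (lerD h1 h2) _.
  have [la lb] := (locint_abs pv.1, locint_abs pp.1).
  rewrite -itgD //; apply: itg_le; [exact: locintD|exact: locintD|].
  move=> u _; have := rhoP u; rewrite /N /al.
  have A1 : `|sigma u * v u + p u + r1 u| <= `|sigma u| * `|v u| + `|p u| + `|r1 u|.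
    apply: le_trans (ler_normD _ _) _; rewrite lerD2r.
    by apply: le_trans (ler_normD _ _) _; rewrite normrM.
  have A2 : `|- sigma u * (sigma u * v u + p u + r1 u) + tau u * v u + r2 u| <=
      `|sigma u| * (`|sigma u| * `|v u| + `|p u| + `|r1 u|) + `|tau u| * `|v u| + `|r2 u|.
    apply: le_trans (ler_normD _ _) _; rewrite lerD2r.
    apply: le_trans (ler_normD _ _) _; rewrite !normrM normrN lerD2r.
    exact: ler_wpM2l.
  have -> : sigma u ^+ 2 = `|sigma u| ^+ 2 by rewrite real_normK ?num_real.
  move=> A3; apply: le_trans (lerD A1 A2) _.
  move: (`|sigma u|) (`|tau u|) (`|v u|) (`|p u|) (`|r1 u|) (`|r2 u|) (rho u)
    (normr_ge0 (sigma u)) (normr_ge0 (tau u)) (normr_ge0 (v u)) (normr_ge0 (p u)) A3.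
  move=> G Ta V P R1 R2 Rh G0 Ta0 V0 P0 A3.
  have B1 := mulr_ge0 V0 (sqr_ge0 (1 - G)); have B2 := mulr_ge0 P0 (sqr_ge0 (1 - G)).
  have B3 := mulr_ge0 P0 (sqr_ge0 G); have B4 := mulr_ge0 P0 Ta0.
  have B5 := mulr_ge0 V0 (sqr_ge0 G).
  by move: A3 B1 B2 B3 B4 B5; rewrite !expr2; lra.
have [g1 g2] := gronwall cN N0 lal al0 lrho rho0 (fun s t _ st _ => key s t st) ab.
have EE : expR (2 * itg al a b) <= E by rewrite ler_expR ler_wpM2l // itg_al.
have I0 : 0 <= itg rho a b by exact: itg_ge0.
by split; [apply: le_trans g1 _|apply: le_trans g2 _]; apply: ler_wpM2l => //; exact: addr_ge0.
Qed.

Lemma quasi_unique x p : prim x (fun t => sigma t * x t + p t) ->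
  prim p (fun t => - sigma t * (sigma t * x t + p t) + tau t * x t) ->
  x 0 = 0 -> p 0 = 0 -> forall t, x t = 0.
Proof.
move=> px pp x0 p0 t.
have px' : prim x (fun t => sigma t * x t + p t + 0).
  by under eq_fun do rewrite addr0.
have pp' : prim p (fun t => - sigma t * (sigma t * x t + p t + 0) + tau t * x t + 0).
  by under eq_fun do rewrite !addr0.
have r0 t' : `|(fun=> 0 : R) t'| * (1 + `|sigma t'|) + `|(fun=> 0 : R) t'| <= (fun=> 0) t'.
  by rewrite normr0 mul0r add0r.
have g a b ab := @quasi_gronwall x p (fun=> 0) (fun=> 0) (fun=> 0) a b px' pp' (locint_cst 0) r0 ab.
apply/eqP; rewrite -normr_le0.
have [t0|t0] := leP 0 t.
  have [h _] := g _ _ t0; move: h; rewrite x0 p0 !normr0 (itg_cst 0 t0) mul0r !addr0 mul0r.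
  by have := normr_ge0 (p t); lra.
have [_ h] := g _ _ (ltW t0); move: h; rewrite x0 p0 !normr0 (itg_cst 0 (ltW t0)) mul0r !addr0 mul0r.
by have := normr_ge0 (p t); lra.
Qed.

Variables (x p : R -> R).
Let w t := sigma t * x t + p t.
Let q t := - sigma t * w t + tau t * x t.
Hypothesis px : prim x w.
Hypothesis pp : prim p q.
Hypothesis Iw : integrableT (fun t => w t ^+ 2).

Let J := \int[mu]_(t in [set: R]) (w t ^+ 2).

Let J_ge a b : itg (fun t => w t ^+ 2) a b <= J.
Proof. by apply: itg_le_total => // t; exact: sqr_ge0. Qed.

Let J0 : 0 <= J.
Proof. by apply: le_trans (J_ge 0 0); rewrite itgxx. Qed.

(** * Estimates for one almost-period *)

Section Step.
Variables (K T e : R).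
Hypothesis xK : forall t, `|x t| <= K.
Hypothesis (T0 : (0 : R) < T) (e0 : (0 : R) < e).

Let ds t := sigma (t + T) - sigma t.
Let dt t := tau (t + T) - tau t.

Hypothesis ds_small : itg (fun t => ds t ^+ 2) (- T) T <= e ^+ 2.
Hypothesis dt_small : itg (fun t => `|dt t|) (- T) T <= e.

Let K0 : 0 <= K.
Proof. exact: le_trans (xK 0). Qed.

Let lds2 : locint (fun t => ds t ^+ 2).
Proof.
apply: locint_sqrB => //; last exact: (locint_shift T lsigma2).
by apply: (measurableT_comp msigma); apply: measurable_funD => //; exact: measurable_cst.
Qed.

Let ldt : locint dt.
Proof. by apply: locintB => //; exact: locint_shift. Qed.

Let lw2 : locint (fun t => w t ^+ 2).
Proof. exact: locint_integrable. Qed.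

(* With [e] exponentially small, this replaces the Cauchy-Schwarz inequality
   for the products involving [ds]. *)
Let amgm a b : `|a| * `|b| <= (2 * e)^-1 * a ^+ 2 + e / 2 * b ^+ 2.
Proof.
have -> : a ^+ 2 = `|a| ^+ 2 by rewrite real_normK ?num_real.
have -> : b ^+ 2 = `|b| ^+ 2 by rewrite real_normK ?num_real.
have i0 : 0 < (2 * e)^-1 by rewrite invr_gt0 mulr_gt0.
have := mulr_ge0 (ltW i0) (sqr_ge0 (`|a| - e * `|b|)).
have -> : (2 * e)^-1 * (`|a| - e * `|b|) ^+ 2 =
    (2 * e)^-1 * `|a| ^+ 2 - `|a| * `|b| + e / 2 * `|b| ^+ 2.
  by field; rewrite gt_eqF.
by lra.
Qed.

(* If the coefficients were [T]-periodic, this Wronskian would be constant. *)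
Let W t := x t * p (t + T) - p t * x (t + T).

(** The difference [W 0 - W (- T)] is the determinant of [(x 0, p 0)] and
    [(x T + x (- T), p T + p (- T))]: exchanging the columns of [W (- T)] turns the minus sign into
    a plus. Its smallness is the near parallelism of [Y(0)] and [Z(0)]. *)
Lemma wronskian_small : `|W 0 - W (- T)| <= e * (K * (1 + J) + K ^+ 2).
Proof.
have px1 := prim_shift T px; have pp1 := prim_shift T pp.
have pW := primB (primM px pp1) (primM pp px1).
have [T1 e1] := (T0, e0); have T0' : - T <= 0 by lra.
apply: le_trans (prim_dist pW T0') _.
have lw1 := locint_shift T lw2.
pose dom t := K * (e^-1 * ds t ^+ 2 + (e / 2) * (w t ^+ 2 + w (t + T) ^+ 2)) +
  K ^+ 2 * `|dt t|.
have ldom : locint dom.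
  apply: locintD; last exact/locintZ/locint_abs.
  by apply: locintZ; apply: locintD; apply: locintZ => //; exact: locintD.
apply: (@le_trans _ _ (itg dom (- T) 0)).
  apply: itg_le => //; first exact/locint_abs/pW.1.
  move=> t _.
  (* As the system is trace-free, everything cancels in the derivative of [W] but the terms with a
     difference of coefficients. *)
  have -> : p (t + T) * w t + x t * q (t + T) - (x (t + T) * q t + p t * w (t + T)) =
     - (ds t * (w t * x (t + T) + x t * w (t + T))) + dt t * (x t * x (t + T)).
    by rewrite /q /ds /dt /w; ring.
  apply: le_trans (ler_normD _ _) _; rewrite normrN !normrM /dom.
  apply: lerD; last first.
    rewrite mulrC ler_wpM2r // expr2.
    by apply: ler_pM.
  have h1 := amgm (ds t) (w t); have h2 := amgm (ds t) (w (t + T)).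
  apply: (@le_trans _ _ (`|ds t| * (K * (`|w t| + `|w (t + T)|)))).
    apply: ler_wpM2l => //; apply: le_trans (ler_normD _ _) _; rewrite !normrM.
    rewrite mulrDr; apply: lerD; first by rewrite mulrC ler_wpM2r.
    by rewrite ler_wpM2r.
  rewrite mulrCA; apply: ler_wpM2l => //; rewrite mulrDr.
  have -> : e^-1 * ds t ^+ 2 + e / 2 * (w t ^+ 2 + w (t + T) ^+ 2) =
    ((2 * e)^-1 * ds t ^+ 2 + e / 2 * w t ^+ 2) + ((2 * e)^-1 * ds t ^+ 2 + e / 2 * w (t + T) ^+ 2).
    by field; rewrite gt_eqF.
  exact: lerD.
rewrite /dom (itgD _ _ (locintZ K (locintD (locintZ _ lds2) (locintZ _ (locintD lw2 lw1)))) (locintZ _ (locint_abs ldt))).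
rewrite !itgZ //; [|exact: locint_abs|by apply: locintD; apply: locintZ => //; exact: locintD].
rewrite (itgD _ _ (locintZ _ lds2) (locintZ _ (locintD lw2 lw1))) !itgZ //; last exact: locintD.
rewrite itgD // (itg_shift T _ _ lw2).
have i1 : itg (fun t => ds t ^+ 2) (- T) 0 <= e ^+ 2.
  by apply: le_trans ds_small; apply: itg_sub => //; [move=> t; exact: sqr_ge0|lra..].
have i2 : itg (fun t => `|dt t|) (- T) 0 <= e.
  by apply: le_trans dt_small; apply: itg_sub => //; [exact: locint_abs|lra..].
have i3 := J_ge (- T) 0; have i4 := J_ge (- T + T) (0 + T).
have j1 : e^-1 * itg (fun t => ds t ^+ 2) (- T) 0 <= e.
  by rewrite ler_pdivrMl // -expr2.
have j2 : e / 2 * (itg (fun t => w t ^+ 2) (- T) 0 + itg (fun t => w t ^+ 2) (- T + T) (0 + T)) <= e / 2 * (J + J).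
  by apply: ler_wpM2l; [rewrite divr_ge0 // ltW|exact: lerD].
have -> : e * (K * (1 + J) + K ^+ 2) = K * (e + e / 2 * (J + J)) + K ^+ 2 * e.
  by field.
apply: lerD; apply: ler_wpM2l => //; [exact: lerD|exact: exprn_ge0].
Qed.

(** Coefficient differences for the backward translate of the solution. On [[0, T]] they are, up to
    sign, the forward differences on [[- T, 0]], so smallness on [[- T, T]] covers both
    translates. *)
Let dsm t := sigma (t + - T) - sigma t.
Let dtm t := tau (t + - T) - tau t.

Let dsmE t : dsm t ^+ 2 = (fun s => ds s ^+ 2) (t + - T).
Proof. by rewrite /= /ds addrNK -sqrrN opprB. Qed.

Let dtmE t : `|dtm t| = (fun s => `|dt s|) (t + - T).
Proof. by rewrite /= /dt addrNK distrC. Qed.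

(** One summand for each part of [rho] in [gordon_step]: the squares of the coefficient differences,
    the weight [1 + sigma ^ 2], the squares of [w], and the differences of [tau]. *)
Let A2 := (K + 1) + 2 * K * (1 + S) + J + 2 * K.

(* [(x, p)] being an exact solution, the terms in [D] cancel in the errors [r1]
   and [r2] with which [(v, vp)] solves the system. *)
Lemma gordon_step D (v := fun t => x (t + T) + x (t + - T) - D * x t)
    (vp := fun t => p (t + T) + p (t + - T) - D * p t) :
  `|v T| + `|vp T| <= (`|v 0| + `|vp 0| + e * A2 * (T + 1)) *
    expR (2 * ((2 + 3 * S) * (T + 1))).
Proof.
have [T1 e1] := (T0, e0).
have pv := primB (primD (prim_shift T px) (prim_shift (- T) px)) (primZ D px).
have pvp := primB (primD (prim_shift T pp) (prim_shift (- T) pp)) (primZ D pp).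
pose r1 t := ds t * x (t + T) + dsm t * x (t + - T).
pose r2 t := - (ds t * w (t + T)) - dsm t * w (t + - T) + dt t * x (t + T) + dtm t * x (t + - T).
have E1 : (fun t => w (t + T) + w (t + - T) - D * w t) =
    (fun t => sigma t * v t + vp t + r1 t).
  by apply/funext => t; rewrite /v /vp /r1 /ds /dsm /w; ring.
rewrite E1 in pv.
have E2 : (fun t => q (t + T) + q (t + - T) - D * q t) =
    (fun t => - sigma t * (sigma t * v t + vp t + r1 t) + tau t * v t + r2 t).
  apply/funext => t; rewrite -(congr1 (fun h => h t) E1) /v /r2 /q /ds /dsm /dt /dtm; ring.
rewrite E2 in pvp.
(* Every product with [ds] or [dsm] is split by [amgm]. In [K + 1], the [K] comes from [r1] against
   [1 + |sigma|] and the 1 from [r2] against the translates of [w]. The squared differences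
   integrate to at most [e ^ 2], which outweighs the factor [(2 * e)^-1]. *)
pose rho t := (K + 1) * (2 * e)^-1 * (ds t ^+ 2 + dsm t ^+ 2) +
  (2 * K * e * (1 + sigma t ^+ 2) + (e / 2 * (w (t + T) ^+ 2 + w (t + - T) ^+ 2) +
   K * (`|dt t| + `|dtm t|))).
have ldsm : locint (fun t => dsm t ^+ 2).
  by rewrite (funext dsmE); exact: (locint_shift (- T) lds2).
have ldtm : locint (fun t => `|dtm t|).
  by rewrite (funext dtmE); exact: (locint_shift (- T) (locint_abs ldt)).
have lw1 := locint_shift T lw2; have lwm := locint_shift (- T) lw2.
have ldta := locint_abs ldt.
have L1 := locintZ ((K + 1) * (2 * e)^-1) (locintD lds2 ldsm).
have L2 := locintZ (2 * K * e) (locintD (locint_cst 1) lsigma2).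
have L3 := locintZ (e / 2) (locintD lw1 lwm).
have L4 := locintZ K (locintD ldta ldtm).
have lrho : locint rho by apply: locintD L1 (locintD L2 (locintD L3 L4)).
have rhoP t : `|r1 t| * (1 + `|sigma t|) + `|r2 t| <= rho t.
  have B1 : `|r1 t| <= K * (`|ds t| + `|dsm t|).
    apply: le_trans (ler_normD _ _) _; rewrite !normrM mulrDr.
    by apply: lerD; rewrite mulrC; apply: ler_wpM2r.
  have B2 : `|r2 t| <= `|ds t| * `|w (t + T)| + `|dsm t| * `|w (t + - T)| +
      K * (`|dt t| + `|dtm t|).
    rewrite /r2 -addrA; apply: le_trans (ler_normD _ _) _; apply: lerD.
      by apply: le_trans (ler_normB _ _) _; rewrite normrN !normrM.
    apply: le_trans (ler_normD _ _) _; rewrite !normrM mulrDr.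
    by apply: lerD; rewrite mulrC; apply: ler_wpM2r.
  have s0 : 0 <= 1 + `|sigma t| by rewrite addr_ge0.
  apply: le_trans (lerD (ler_wpM2r s0 B1) B2) _.
  have C1 := amgm (ds t) (1 + `|sigma t|); have C2 := amgm (dsm t) (1 + `|sigma t|).
  have C3 := amgm (ds t) (w (t + T)); have C4 := amgm (dsm t) (w (t + - T)).
  rewrite (ger0_norm s0) in C1 C2.
  have C5 : (1 + `|sigma t|) ^+ 2 <= 2 * (1 + sigma t ^+ 2).
    have -> : sigma t ^+ 2 = `|sigma t| ^+ 2 by rewrite real_normK ?num_real.
    by have := sqr_ge0 (1 - `|sigma t|); rewrite !expr2; lra.
  have C6 : e / 2 * (1 + `|sigma t|) ^+ 2 <= e / 2 * (2 * (1 + sigma t ^+ 2)).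
    by apply: ler_wpM2l => //; rewrite divr_ge0 // ltW.
  have C7 : `|ds t| * (1 + `|sigma t|) + `|dsm t| * (1 + `|sigma t|) <=
     (2 * e)^-1 * (ds t ^+ 2 + dsm t ^+ 2) + 2 * e * (1 + sigma t ^+ 2) by lra.
  have C8 := ler_wpM2l K0 C7.
  by rewrite /rho; move: C8 C3 C4; lra.
have [g _] := quasi_gronwall pv pvp lrho rhoP (ltW T0).
rewrite subr0 in g; apply: le_trans g _.
apply: ler_wpM2r; first exact: expR_ge0.
rewrite lerD2l /rho.
rewrite (itgD _ _ L1 (locintD L2 (locintD L3 L4))) (itgD _ _ L2 (locintD L3 L4)) (itgD _ _ L3 L4).
rewrite (itgZ _ _ _ (locintD lds2 ldsm)) (itgZ _ _ _ (locintD (locint_cst 1) lsigma2)).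
rewrite (itgZ _ _ _ (locintD lw1 lwm)) (itgZ _ _ _ (locintD ldta ldtm)).
rewrite (itgD _ _ lds2 ldsm) (itgD _ _ (locint_cst 1) lsigma2) (itgD _ _ lw1 lwm) (itgD _ _ ldta ldtm).
have sq0 f t : 0 <= f t ^+ 2 by exact: sqr_ge0.
have i1 : itg (fun t => ds t ^+ 2) 0 T <= e ^+ 2.
  by apply: le_trans ds_small; apply: itg_sub => //; lra.
have i2 : itg (fun t => dsm t ^+ 2) 0 T <= e ^+ 2.
  rewrite (funext dsmE).
  rewrite (itg_shift (- T) 0 T lds2) add0r subrr.
  by apply: le_trans ds_small; apply: itg_sub => //; lra.
have i3 : itg (fun t => `|dt t|) 0 T <= e.
  by apply: le_trans dt_small; apply: itg_sub => //; lra.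
have i4 : itg (fun t => `|dtm t|) 0 T <= e.
  rewrite (funext dtmE).
  rewrite (itg_shift (- T) 0 T ldta) add0r subrr.
  by apply: le_trans dt_small; apply: itg_sub => //; lra.
have i5 : itg (fun t => w (t + T) ^+ 2) 0 T <= J by rewrite (itg_shift T 0 T lw2).
have i6 : itg (fun t => w (t + - T) ^+ 2) 0 T <= J by rewrite (itg_shift (- T) 0 T lw2).
have i7 : itg (fun t => sigma t ^+ 2) 0 T <= S * (T + 1).
  by rewrite -{1}[T]add0r; apply: itg_unif => //; exact: ltW.
rewrite itg_cst ?(ltW T0) // mul1r subr0.
have j1 : (K + 1) * (2 * e)^-1 * (itg (fun t => ds t ^+ 2) 0 T + itg (fun t => dsm t ^+ 2) 0 T)
    <= (K + 1) * e.
  have -> : (K + 1) * e = (K + 1) * (2 * e)^-1 * (e ^+ 2 + e ^+ 2).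
    by field; rewrite gt_eqF.
  apply: ler_wpM2l; last exact: lerD.
  by rewrite mulr_ge0 ?invr_ge0 ?addr_ge0 // mulr_ge0 // ltW.
have j2 : 2 * K * e * (T + itg (fun t => sigma t ^+ 2) 0 T) <= 2 * K * e * ((1 + S) * (T + 1)).
  by apply: ler_wpM2l; [rewrite !mulr_ge0 // ltW|lra].
have j3 : e / 2 * (itg (fun t => w (t + T) ^+ 2) 0 T + itg (fun t => w (t + - T) ^+ 2) 0 T) <= e / 2 * (J + J).
  by apply: ler_wpM2l; [rewrite divr_ge0 // ltW|exact: lerD].
have j4 : K * (itg (fun t => `|dt t|) 0 T + itg (fun t => `|dtm t|) 0 T) <= K * (e + e).
  by apply: ler_wpM2l => //; exact: lerD.
apply: le_trans (lerD j1 (lerD j2 (lerD j3 j4))) _.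
have k1 := mulr_ge0 (mulr_ge0 (ltW e0) K0) (ltW T0).
have k2 := mulr_ge0 (mulr_ge0 (ltW e0) J0) (ltW T0).
have k3 := mulr_ge0 (ltW e0) (ltW T0).
by rewrite /A2; lra.
Qed.

End Step.

Hypotheses (vx : vanishes x) (vp : vanishes p).
Hypothesis gordon : forall C M : R, exists T, [/\ 0 < T, M <= T,
  itg (fun t => (sigma (t + T) - sigma t) ^+ 2) (- T) T <= expR (- (C * T)) ^+ 2 &
  itg (fun t => `|tau (t + T) - tau t|) (- T) T <= expR (- (C * T))].

(** Scalar form of the alternative on [|D|], applied to [x] and to [p] with the same [D]. Either
    case bounds [a0] by three terms of size [n]; the factor 5 leaves room. *)
Let dominate (D a0 a1 a2 am k0 k1 n : R) :
  k0 = a1 + am - D * a0 -> k1 = a2 + a0 - D * a1 ->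
  `|k0| <= n -> `|k1| <= n -> `|a1| <= n -> `|a2| <= n -> `|am| <= n -> `|a0| <= 5 * n.
Proof.
move=> E0 E1 h0 h1 h2 h3 h4.
have n0 : 0 <= n by exact: le_trans h0.
have [D1|D1] := leP `|D| 1.
  have -> : a0 = k1 - a2 + D * a1 by rewrite E1; ring.
  apply: le_trans (ler_normD _ _) _; have := ler_normB k1 a2.
  have : `|D * a1| <= `|a1| by rewrite normrM ler_piMl.
  by lra.
have : `|a0| <= `|D * a0| by rewrite normrM ler_peMl // ltW.
have -> : D * a0 = a1 + am - k0 by rewrite E0; ring.
by have := ler_normB (a1 + am) k0; have := ler_normD a1 am; lra.
Qed.

Lemma gordon_initial : x 0 = 0 /\ p 0 = 0.
Proof.
have [K K0 xK] := vanishes_bounded (prim_continuous px) vx.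
pose A1 := K * (1 + J) + K ^+ 2.
pose A2 := (K + 1) + 2 * K * (1 + S) + J + 2 * K.
have [S0' J0'] := (S0, J0).
have A10 : 0 <= A1 by rewrite addr_ge0 ?exprn_ge0 // mulr_ge0 //; lra.
have A20 : 0 <= A2.
  have : 0 <= K * (1 + S) by rewrite mulr_ge0 //; lra.
  by rewrite /A2; lra.
(* [c] is the modulus of a nonzero component of [Y(0)], the divisor in the definition of [D]. The
   conclusion contradicts [c > 0] when [n = c / 2]. *)
have main c : 0 < c -> (c = `|x 0| \/ c = `|p 0|) ->
    forall n, 0 < n -> `|x 0| <= n /\ `|p 0| <= n.
  move=> c0 cE n n0.
  (* [C0] is the rate in [gordon_step]; [B * expR (- T)] will bound the total error at [0] and at
     [T]. *)
  pose C0 := 2 * (2 + 3 * S); pose B := (A1 / c + A2) * expR C0.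
  have A1c : 0 <= A1 / c by rewrite divr_ge0 // ltW.
  have C00 : 0 <= C0 by rewrite /C0; lra.
  have B0 : 0 <= B by rewrite mulr_ge0 ?expR_ge0 // addr_ge0.
  have n5 : 0 < n / 5 by lra.
  have [M1 M1P] := vx n5; have [M2 M2P] := vp n5.
  pose M := `|M1| + `|M2| + B / (n / 5).
  (* In the rate [C0 + 2], [C0] cancels the Gronwall factor, one unit absorbs [T + 1], and the other
     leaves [expR (- T)]. The bound [M <= T] makes [B * expR (- T)] at most [n / 5] and puts [T],
     [2 T] and [- T] in the region where [x] and [p] are small. *)
  have [T [T0 MT ds_small dt_small]] := gordon (C0 + 2) M.
  set e := expR _ in ds_small dt_small.
  have e0 : 0 < e by exact: expR_gt0.
  have BT : B * expR (- T) <= n / 5.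
    have BM : B / (n / 5) <= T.
      by have := normr_ge0 M1; have := normr_ge0 M2; move: MT; rewrite /M; lra.
    rewrite expRN ler_pdivrMr ?expR_gt0 //.
    rewrite ler_pdivrMr // in BM; rewrite mulrC.
    have h := ler_wpM2r (ltW n5) (expR_ge1Dx T); apply: le_trans h.
    by rewrite mulrDl mul1r; lra.
  have eT : e * (T + 1) * expR (C0 * (T + 1)) <= expR C0 * expR (- T).
    have -> : e * (T + 1) * expR (C0 * (T + 1)) = expR C0 * expR (- T) * ((T + 1) * expR (- T)).
      have a1 : e = expR (- T) * (expR (- T) * expR (- (C0 * T))).
        by rewrite /e -!expRD; congr expR; ring.
      have a2 : expR (C0 * (T + 1)) = expR (C0 * T) * expR C0.
        by rewrite -expRD; congr expR; ring.
      have a3 : expR (- (C0 * T)) * expR (C0 * T) = 1 by rewrite -expRD addNr expR0.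
      by rewrite a1 a2 -[RHS]mulr1 -a3; ring.
    rewrite ler_piMr ?mulr_ge0 ?expR_ge0 //.
    by rewrite expRN ler_pdivrMr ?expR_gt0 // mul1r addrC expR_ge1Dx.
  have e_le : e <= expR C0 * expR (- T).
    apply: le_trans eT; rewrite -[leLHS]mulr1 -mulrA; apply: ler_wpM2l; first exact: ltW.
    have g1 : 1 <= expR (C0 * (T + 1)).
      by rewrite -[X in X <= _]expR0 ler_expR mulr_ge0 //; lra.
    have : 1 * 1 <= (T + 1) * expR (C0 * (T + 1)) by apply: ler_pM => //; lra.
    by rewrite mul1r.
  have W := wronskian_small xK T0 e0 ds_small dt_small.
  (* This [D] makes one component of [Z(0) - D Y(0)] vanish exactly; the other is, up to sign, the
     determinant bounded by [wronskian_small] divided by the nonzero component. *)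
  have [D DP] : exists D, `|x (0 + T) + x (0 + - T) - D * x 0| +
      `|p (0 + T) + p (0 + - T) - D * p 0| <= e * (A1 / c).
    have EW : x 0 * (p (0 + T) + p (0 + - T)) - p 0 * (x (0 + T) + x (0 + - T)) =
        x 0 * p (0 + T) - p 0 * x (0 + T) - (x (- T) * p (- T + T) - p (- T) * x (- T + T)).
      by rewrite addNr !add0r; ring.
    rewrite -EW -/A1 in W.
    have cn : c != 0 by rewrite gt_eqF.
    case: cE => cE.
      have x0 : x 0 != 0 by rewrite -normr_gt0 -cE.
      exists ((x (0 + T) + x (0 + - T)) / x 0).
      rewrite divfK // subrr normr0 add0r mulrA ler_pdivlMr // cE -normrM.
      by rewrite (_ : _ * x 0 = x 0 * (p (0 + T) + p (0 + - T)) - p 0 * (x (0 + T) + x (0 + - T))) //; field.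
    have p0 : p 0 != 0 by rewrite -normr_gt0 -cE.
    exists ((p (0 + T) + p (0 + - T)) / p 0).
    rewrite divfK // subrr normr0 addr0 mulrA ler_pdivlMr // cE -normrM -normrN.
    by rewrite (_ : - (_ * p 0) = x 0 * (p (0 + T) + p (0 + - T)) - p 0 * (x (0 + T) + x (0 + - T))) //; field.
  have V := gordon_step xK T0 e0 ds_small dt_small D.
  rewrite -/A2 mulrA -/C0 in V.
  have N0 : e * (A1 / c) <= n / 5.
    apply: le_trans BT; rewrite /B mulrC -mulrA.
    apply: (@le_trans _ _ (A1 / c * (expR C0 * expR (- T)))); first exact: ler_wpM2l.
    by apply: ler_wpM2r; [rewrite mulr_ge0 ?expR_ge0|lra].
  have NT : `|x (T + T) + x (T + - T) - D * x T| + `|p (T + T) + p (T + - T) - D * p T| <= n / 5.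
    apply: le_trans V _; apply: le_trans BT.
    have h : e * (A1 / c) <= A1 / c * (e * (T + 1)).
      rewrite (_ : A1 / c * (e * (T + 1)) = e * (A1 / c) * (T + 1)); last by ring.
      have h0 : 0 <= e * (A1 / c) by apply: mulr_ge0 => //; exact: ltW.
      have T1 : 1 <= T + 1 by rewrite lerDr ltW.
      exact: ler_peMr.
    have h2 : `|x (0 + T) + x (0 + - T) - D * x 0| + `|p (0 + T) + p (0 + - T) - D * p 0| + e * A2 * (T + 1) <=
        (A1 / c + A2) * (e * (T + 1)) by lra.
    apply: le_trans (ler_wpM2r (expR_ge0 _) h2) _.
    rewrite /B -[leLHS]mulrA -[leRHS]mulrA.
    by apply: ler_wpM2l => //; exact: addr_ge0.
  rewrite !add0r in DP; rewrite subrr in NT.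
  have nT : `|T| = T by rewrite ger0_norm // ltW.
  have BM0 : 0 <= B / (n / 5) by rewrite divr_ge0 // ltW.
  have TM1 : M1 <= T.
    apply: le_trans (ler_norm M1) (le_trans _ MT).
    by rewrite /M -addrA lerDl addr_ge0.
  have TM2 : M2 <= T.
    apply: le_trans (ler_norm M2) (le_trans _ MT).
    by rewrite /M addrAC lerDr addr_ge0.
  have [t1 t2 t3] : [/\ T <= `|T|, T <= `|T + T| & T <= `|- T|].
    rewrite normrN nT; split=> //.
    by rewrite ger0_norm ?addr_ge0 ?lerDl ?(ltW T0).
  have -> : n = 5 * (n / 5) by field.
  have DP' := le_trans DP N0.
  move: DP' NT; set k0 := x T + _ - _; set l0 := p T + _ - _.
  set k1 := x (T + T) + _ - _; set l1 := p (T + T) + _ - _ => H0 H1.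
  split.
    apply: (@dominate D _ (x T) (x (T + T)) (x (- T)) k0 k1) => //.
    - by apply: le_trans H0; rewrite lerDl.
    - by apply: le_trans H1; rewrite lerDl.
    - by apply: M1P; exact: le_trans t1.
    - by apply: M1P; exact: le_trans t2.
    - by apply: M1P; exact: le_trans t3.
  apply: (@dominate D _ (p T) (p (T + T)) (p (- T)) l0 l1) => //.
  - by apply: le_trans H0; rewrite lerDr.
  - by apply: le_trans H1; rewrite lerDr.
  - by apply: M2P; exact: le_trans t1.
  - by apply: M2P; exact: le_trans t2.
  - by apply: M2P; exact: le_trans t3.
have zero c : 0 < c -> (c = `|x 0| \/ c = `|p 0|) -> False.
  move=> c0 cE; have c2 : 0 < c / 2 by lra.
  by have [] := main c c0 cE _ c2; case: cE => <-; lra.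
split; apply/eqP; rewrite -normr_le0 leNgt; apply/negP => h.
  exact: (zero _ h (or_introl erefl)).
exact: (zero _ h (or_intror erefl)).
Qed.

Lemma gordon_trivial t : x t = 0.
Proof.
have [x0 p0] := gordon_initial.
exact: (quasi_unique px pp).
Qed.

End QuasiSystem.

(** * Reduction to real-valued data *)

Section ComplexLp.
Context {R : realType}.
Local Notation mu := (@lebesgue_measure R).
Implicit Types (f : R -> R[i]) (g : R -> R) (A : set R) (c : R) (z : R[i]).

Lemma modulus_ge0 z : 0 <= modulus z.
Proof. by case: z => a b; exact: sqrtr_ge0. Qed.

Lemma modulusE z : modulus z ^+ 2 = complex.Re z ^+ 2 + complex.Im z ^+ 2.
Proof. by case: z => a b; rewrite /modulus /= sqr_sqrtr // addr_ge0 ?sqr_ge0. Qed.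

Lemma Re_le_modulus z : `|complex.Re z| <= modulus z.
Proof.
rewrite -ler_sqr ?nnegrE ?modulus_ge0 // real_normK ?num_real // modulusE.
by rewrite lerDl sqr_ge0.
Qed.

Lemma Im_le_modulus z : `|complex.Im z| <= modulus z.
Proof.
rewrite -ler_sqr ?nnegrE ?modulus_ge0 // real_normK ?num_real // modulusE.
by rewrite lerDr sqr_ge0.
Qed.

Lemma measurable_modulus f : cmeasurable f ->
  measurable_fun [set: R] (fun t => modulus (f t)).
Proof.
move=> [mRe mIm].
have -> : (fun t => modulus (f t)) =
    Num.sqrt \o (fun t => complex.Re (f t) ^+ 2 + complex.Im (f t) ^+ 2).
  by apply/funext => t; rewrite /= -modulusE sqrtr_sqr ger0_norm // modulus_ge0.
apply: measurableT_comp.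
  by apply: continuous_measurable_fun; exact: sqrt_continuous.
by apply: measurable_funD; exact: measurable_funX.
Qed.

Lemma Lp_norm1E A f : measurable A ->
  Lp_norm 1 A f = (\int[mu]_(t in A) (modulus (f t))%:E)%E.
Proof.
move=> mA; rewrite /Lp_norm Lnorm1 [RHS]integral_mkcond; apply: eq_integral => t _.
by rewrite patchE; case: ifP => _; rewrite ?normr0 //= ger0_norm // modulus_ge0.
Qed.

Lemma Lp_norm2E A f : measurable A ->
  Lp_norm 2 A f = ((\int[mu]_(t in A) (modulus (f t) ^+ 2)%:E) `^ 2^-1)%E.
Proof.
move=> mA; rewrite /Lp_norm unlock /Lnorm; congr (_ `^ _)%E.
rewrite [RHS]integral_mkcond; apply: eq_integral => t _.
rewrite !patchE; case: ifP => _ /=; last by rewrite normr0 powR0 // pnatr_eq0.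
by rewrite ger0_norm ?modulus_ge0 // powR_mulrn // modulus_ge0.
Qed.

Lemma integrable_dom A g (h : R -> R) c : measurable A -> measurable_fun [set: R] g ->
  measurable_fun [set: R] h -> (forall t, `|g t| <= h t) ->
  (\int[mu]_(t in A) (h t)%:E <= c%:E)%E ->
  mu.-integrable A (EFin \o g) /\ \int[mu]_(t in A) `|g t| <= c.
Proof.
move=> mA mg mh gh hc.
have h0 t : 0 <= h t by exact: le_trans (gh t).
have le1 : (\int[mu]_(t in A) `|(g t)%:E| <= c%:E)%E.
  apply: le_trans hc; apply: ge0_le_integral => //.
  - by apply/measurable_EFinP; apply: measurable_funTS; apply: measurableT_comp.
  - by apply/measurable_EFinP; exact: measurable_funTS.
  - by move=> t _; rewrite lee_fin.
have Ig : mu.-integrable A (EFin \o g).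
  apply/integrableP; split; first exact/measurable_EFinP/measurable_funTS.
  exact: le_lt_trans le1 (ltry _).
split=> //; rewrite -lee_fin; apply: le_trans le1; rewrite /Rintegral fineK //.
by apply: integrable_fin_num => //; exact: integrable_norm.
Qed.

Lemma Lp_norm1_dom A f g c : measurable A -> cmeasurable f ->
  measurable_fun [set: R] g -> (forall t, `|g t| <= modulus (f t)) ->
  (Lp_norm 1 A f <= c%:E)%E ->
  mu.-integrable A (EFin \o g) /\ \int[mu]_(t in A) `|g t| <= c.
Proof.
move=> mA mf mg gf; rewrite Lp_norm1E // => fc.
exact: (integrable_dom mA mg (measurable_modulus mf) gf fc).
Qed.

Lemma Lp_norm2_dom A f g c : measurable A -> cmeasurable f ->
  measurable_fun [set: R] g -> (forall t, `|g t| <= modulus (f t)) ->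
  0 <= c -> (Lp_norm 2 A f <= c%:E)%E ->
  mu.-integrable A (EFin \o (fun t => g t ^+ 2)) /\
  \int[mu]_(t in A) (g t ^+ 2) <= c ^+ 2.
Proof.
move=> mA mf mg gf c0; rewrite Lp_norm2E // => fc.
have I2 : (\int[mu]_(t in A) (modulus (f t) ^+ 2)%:E <= (c ^+ 2)%:E)%E.
  set I := integral _ _ _ in fc *.
  have I0 : (0 <= I)%E by apply: integral_ge0 => t _; rewrite lee_fin sqr_ge0.
  have -> : I = ((I `^ 2^-1) `^ 2)%E.
    by rewrite -poweRrM mulVf ?pnatr_eq0 // poweRe1.
  have -> : ((c ^+ 2)%:E = c%:E `^ 2)%E by rewrite poweR_EFin powR_mulrn.
  apply: gt0_ler_poweR => //; rewrite in_itv /= ?leey ?andbT ?poweR_ge0 //.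
have dom t : `|g t ^+ 2| <= modulus (f t) ^+ 2.
  by rewrite normrX lerXn2r ?nnegrE ?modulus_ge0.
have [Ig Igc] := integrable_dom mA (measurable_funX 2 mg)
  (measurable_funX 2 (measurable_modulus mf)) dom I2.
split=> //; apply: le_trans Igc; rewrite le_eqVlt; apply/orP; left; apply/eqP.
by apply: eq_Rintegral => t _; rewrite ger0_norm ?sqr_ge0.
Qed.

End ComplexLp.

(** * Real and imaginary parts of the data *)

Section Glue.
Context {R : realType}.
Local Notation mu := (@lebesgue_measure R).
Implicit Types (f g u : R -> R[i]) (h : R -> R) (a b c t p : R) (z : R[i]).

Lemma locint_unit h : measurable_fun [set: R] h ->
  (forall t, mu.-integrable `[t, t + 1] (EFin \o h)) -> locint h.
Proof.
move=> mh Ih; split=> // a b.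
have step n : mu.-integrable `[a, a + n%:R] (EFin \o h).
  elim: n => [|n IH].
    by apply: integrableS (Ih a) => //; apply: subset_itvl; rewrite bnd_simp addr0 lerDl.
  have n0 : (0 : R) <= n%:R by [].
  have -> : `[a, a + n.+1%:R]%classic = `[a, a + n%:R] `|` `]a + n%:R, a + n%:R + 1].
    rewrite -natr1; apply/seteqP; split=> t /=; rewrite !in_itv /=.
      by move=> /andP[t1 t2]; have [t3|t3] := leP t (a + n%:R); [left|right]; apply/andP; split; lra.
    by case=> /andP[t1 t2]; apply/andP; split; lra.
  apply/integrableP; split; first exact/measurable_EFinP/measurable_funTS.
  rewrite ge0_integral_setU //=; last 2 first.
  - by apply/measurable_EFinP/measurable_funTS; exact: measurableT_comp.
  - by apply/disj_setPS => t [/=]; rewrite !in_itv /= => /andP[_ t1] /andP[]; rewrite ltNge t1.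
  apply: lte_add_pinfty; first by have /integrableP[] := IH.
  have : mu.-integrable `]a + n%:R, a + n%:R + 1] (EFin \o h).
    by apply: integrableS (Ih (a + n%:R)) => //; exact: subset_itv_oc_cc.
  by case/integrableP.
have [ab|ba] := leP a b; last first.
  by rewrite set_itv_ge ?bnd_simp -?ltNge //; exact: integrable_set0.
apply: integrableS (step (Num.bound (b - a))) => //; apply: subset_itvl.
rewrite bnd_simp -lerBlDl ltW //; apply: archi_boundP; lra.
Qed.

Lemma Lp_norm_unif p f t : (Lp_norm p `[t, (t + 1)%R] f <= Lp_unif_norm p f)%E.
Proof. by apply: ereal_sup_ubound; exists t. Qed.

Lemma Lp_unif_bound p f : Lp_unif p f -> exists2 c, 0 <= c &
  forall t, (Lp_norm p `[t, (t + 1)%R] f <= c%:E)%E.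
Proof.
move=> [mf fy]; have h t := Lp_norm_unif p f t.
have N0 : (0 <= Lp_unif_norm p f)%E by apply: le_trans (h 0); exact: Lnorm_ge0.
exists (fine (Lp_unif_norm p f)); first exact: fine_ge0.
by move=> t; rewrite fineK // ge0_fin_numE.
Qed.

Lemma Lp_unif2_Re f (s := fun t => complex.Re (f t)) : Lp_unif 2 f ->
  [/\ measurable_fun [set: R] s, locint (fun t => s t ^+ 2) &
      exists S, forall t, itg (fun r => s r ^+ 2) t (t + 1) <= S].
Proof.
move=> uf; have [c c0 cP] := Lp_unif_bound uf; have [[mR mI] _] := uf.
have D t := Lp_norm2_dom (measurable_itv `[t, t + 1]) (conj mR mI) mR
  (fun t => Re_le_modulus (f t)) c0 (cP t).
split=> //; first by apply: locint_unit; [exact: measurable_funX|move=> t; have [] := D t].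
by exists (c ^+ 2) => t; have [] := D t.
Qed.

Lemma Lp_unif1_Re f (s := fun t => complex.Re (f t)) : Lp_unif 1 f ->
  locint s /\ exists S, forall t, itg (fun r => `|s r|) t (t + 1) <= S.
Proof.
move=> uf; have [c c0 cP] := Lp_unif_bound uf; have [[mR mI] _] := uf.
have D t := Lp_norm1_dom (measurable_itv `[t, t + 1]) (conj mR mI) mR
  (fun t => Re_le_modulus (f t)) (cP t).
split=> //; first by apply: locint_unit => // t; have [] := D t.
by exists c => t; have [] := D t.
Qed.

Lemma Lp2_integrable f h : Lp 2 f -> measurable_fun [set: R] h ->
  (forall t, `|h t| <= modulus (f t)) -> integrableT (fun t => h t ^+ 2).
Proof.
move=> [mf fy] mh hf.
have N0 : (0 <= Lp_norm 2 [set: R] f)%E by exact: Lnorm_ge0.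
have c0 := fine_ge0 N0.
have hN : (Lp_norm 2 [set: R] f <= (fine (Lp_norm 2 [set: R] f))%:E)%E.
  by rewrite fineK // ge0_fin_numE.
by have [] := Lp_norm2_dom measurableT mf mh hf c0 hN.
Qed.

(** Test functions are real, so the weak identity splits into its real and imaginary parts, to which
    [weak_prim] applies separately. *)
Lemma weak_derivative_prim f g : weak_derivative f g -> exists F : (R -> R) * (R -> R),
  [/\ prim F.1 (fun t => complex.Re (g t)), prim F.2 (fun t => complex.Im (g t)),
      ae_eq mu [set: R] (fun t => complex.Re (f t)) F.1 &
      ae_eq mu [set: R] (fun t => complex.Im (f t)) F.2].
Proof.
move=> [[fR fI] [gR gI] W].
have ReM (z : R[i]) (r : R) : complex.Re (z * r%:C%C) = complex.Re z * r.
  by case: z => a b; rewrite /= mulr0 subr0.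
have ImM (z : R[i]) (r : R) : complex.Im (z * r%:C%C) = complex.Im z * r.
  by case: z => a b; rewrite /= mulr0 add0r.
have WR phi : test_function phi ->
    \int[mu]_(t in [set: R]) (complex.Re (f t) * derive1 phi t) =
    - \int[mu]_(t in [set: R]) (complex.Re (g t) * phi t).
  move=> /W /(congr1 (@complex.Re R)); rewrite /cintegral /=.
  by under eq_Rintegral do rewrite ReM; under [in X in _ = - X -> _]eq_Rintegral do rewrite ReM.
have WI phi : test_function phi ->
    \int[mu]_(t in [set: R]) (complex.Im (f t) * derive1 phi t) =
    - \int[mu]_(t in [set: R]) (complex.Im (g t) * phi t).
  move=> /W /(congr1 (@complex.Im R)); rewrite /cintegral /=.
  by under eq_Rintegral do rewrite ImM; under [in X in _ = - X -> _]eq_Rintegral do rewrite ImM.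
have [F1 F1p F1e] := weak_prim fR gR WR.
have [F2 F2p F2e] := weak_prim fI gI WI.
by exists (F1, F2).
Qed.

End Glue.

(** * Real and nonreal eigenvalues *)

Section RealCore.
Context {R : realType}.
Implicit Types (f g h x y p q : R -> R) (a b c s t : R).

Lemma vanishesD f g : vanishes f -> vanishes g -> vanishes (fun t => f t + g t).
Proof.
move=> vf vg e e0; have e2 : 0 < e / 2 by lra.
have [M1 h1] := vf _ e2; have [M2 h2] := vg _ e2.
exists (Num.max M1 M2) => t; rewrite ge_max => /andP[t1 t2].
by have := ler_normD (f t) (g t); have := h1 t t1; have := h2 t t2; lra.
Qed.

Lemma vanishesM f g : vanishes f -> vanishes g -> vanishes (fun t => f t * g t).
Proof.
move=> vf vg e e0; have [M1 h1] := vf _ ltr01; have [M2 h2] := vg _ e0.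
exists (Num.max M1 M2) => t; rewrite ge_max => /andP[t1 t2].
by rewrite normrM -[leRHS]mul1r; apply: ler_pM => //; [exact: h1|exact: h2].
Qed.

Lemma vanishesZ c f : vanishes f -> vanishes (fun t => c * f t).
Proof.
move=> vf e e0; have c1 : 0 < `|c| + 1 by have := normr_ge0 c; lra.
have [M hM] := vf _ (divr_gt0 e0 c1).
exists M => t /hM; rewrite ler_pdivlMr // normrM => h.
by have := normr_ge0 (f t); move: h; lra.
Qed.

Lemma itg_eq0 h : continuous h -> (forall a b, a <= b -> itg h a b = 0) ->
  forall t, h t = 0.
Proof.
move=> ch h0 t; have pH := prim_primitive (locint_continuous ch).
have PE : primitive h = cst (primitive h 0).
  apply/funext => r /=; apply/eqP; rewrite -subr_eq0; apply/eqP.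
  have [r0|r0] := leP 0 r; first by rewrite pH.2 // h0.
  by rewrite -opprB pH.2 ?h0 ?oppr0 // ltW.
have [_ <-] := prim_is_derive t pH ch.
by rewrite PE derive_cst.
Qed.

Variables (sigma tau : R -> R) (S : R).
Hypothesis msigma : measurable_fun [set: R] sigma.
Hypothesis lsigma2 : locint (fun t => sigma t ^+ 2).
Hypothesis ltau : locint tau.
Hypothesis sigmaS : forall t, itg (fun s => sigma s ^+ 2) t (t + 1) <= S.
Hypothesis tauS : forall t, itg (fun s => `|tau s|) t (t + 1) <= S.
Hypothesis gordon : forall C M : R, exists T, [/\ 0 < T, M <= T,
  itg (fun t => (sigma (t + T) - sigma t) ^+ 2) (- T) T <= expR (- (C * T)) ^+ 2 &
  itg (fun t => `|tau (t + T) - tau t|) (- T) T <= expR (- (C * T))].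

(** A real eigenvalue is absorbed into [tau]: subtracting a constant leaves the differences
    [tau (t + T) - tau t] unchanged and enlarges the uniform bound by at most [|al|]. *)
Lemma real_trivial al x p :
  prim x (fun t => sigma t * x t + p t) ->
  prim p (fun t => - sigma t * (sigma t * x t + p t) + tau t * x t - al * x t) ->
  integrableT (fun t => (sigma t * x t + p t) ^+ 2) ->
  vanishes x -> vanishes p -> forall t, x t = 0.
Proof.
move=> px pp Iw vx vp.
pose tau' t := tau t - al.
have pp' : prim p (fun t => - sigma t * (sigma t * x t + p t) + tau' t * x t).
  by congr (prim p _): pp; apply/funext => t; rewrite /tau'; ring.
have ltau' : locint tau' by apply: locintB => //; exact: locint_cst.
have S0 : 0 <= S by apply: le_trans (sigmaS 0); apply: itg_ge0 => t; exact: sqr_ge0.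
have lta := locint_abs ltau.
have tauS' t : itg (fun s => `|tau' s|) t (t + 1) <= S + `|al|.
  have h : itg (fun s => `|tau s| + `|al|) t (t + 1) <= S + `|al|.
    rewrite itgD //; last exact: locint_cst.
    rewrite itg_cst; last by lra.
    by rewrite addrAC subrr add0r mulr1 lerD2r.
  apply: le_trans h; apply: itg_le; first exact: locint_abs.
    by apply: locintD => //; exact: locint_cst.
  by move=> s _; exact: ler_normB.
have sigmaS' t : itg (fun s => sigma s ^+ 2) t (t + 1) <= S + `|al|.
  by apply: le_trans (sigmaS t) _; rewrite lerDl.
apply: (gordon_trivial msigma lsigma2 ltau' sigmaS' tauS' px pp' Iw vx vp).
move=> C M; have [T [T0 MT h1 h2]] := gordon C M; exists T; split=> //.
by congr (_ <= _): h2; congr itg; apply/funext => t; rewrite /tau'; congr `|_|; ring.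
Qed.

(** The eigenvalue is [al + i be]. If [be = 0], the systems for the real and imaginary parts
    decouple. Otherwise the Wronskian is monotone and vanishes at both ends of the line, which
    leaves no mass for [x ^ 2 + y ^ 2]. *)
Lemma complex_trivial al be x y p q :
  prim x (fun t => sigma t * x t + p t) ->
  prim y (fun t => sigma t * y t + q t) ->
  prim p (fun t => - sigma t * (sigma t * x t + p t) + tau t * x t -
    (al * x t - be * y t)) ->
  prim q (fun t => - sigma t * (sigma t * y t + q t) + tau t * y t -
    (al * y t + be * x t)) ->
  integrableT (fun t => x t ^+ 2) -> integrableT (fun t => y t ^+ 2) ->
  integrableT (fun t => (sigma t * x t + p t) ^+ 2) ->
  integrableT (fun t => (sigma t * y t + q t) ^+ 2) ->
  (forall t, x t = 0) /\ (forall t, y t = 0).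
Proof.
move=> px py pp pq Ix Iy Iwx Iwy.
have vx := vanishes_prim_L2 px Ix Iwx; have vy := vanishes_prim_L2 py Iy Iwy.
have vlx : vanishes (fun t => al * x t - be * y t).
  have := vanishesD (vanishesZ al vx) (vanishesZ (- be) vy).
  by under eq_fun do rewrite mulNr.
have vly : vanishes (fun t => al * y t + be * x t).
  exact: vanishesD (vanishesZ al vy) (vanishesZ be vx).
have vp := vanishes_quasi lsigma2 ltau sigmaS tauS px pp Iwx vx vlx.
have vq := vanishes_quasi lsigma2 ltau sigmaS tauS py pq Iwy vy vly.
have [be0|be0] := eqVneq be 0.
  split; [apply: (real_trivial px _ Iwx vx vp (al := al))|
          apply: (real_trivial py _ Iwy vy vq (al := al))].
    by congr (prim p _): pp; apply/funext => t; rewrite be0; ring.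
  by congr (prim q _): pq; apply/funext => t; rewrite be0; ring.
(* [x q - y p] is, up to a constant factor, the Wronskian of [u] and its
   conjugate; its derivative is [- be (x ^ 2 + y ^ 2)]. *)
have pW := primB (primM px pq) (primM py pp).
have vW : vanishes (fun t => x t * q t - y t * p t).
  have := vanishesD (vanishesM vx vq) (vanishesZ (- 1) (vanishesM vy vp)).
  by under eq_fun do rewrite mulN1r.
set W := (fun t => x t * q t - y t * p t) in pW vW.
pose h t := x t ^+ 2 + y t ^+ 2.
have h0 t : 0 <= h t by rewrite addr_ge0 ?sqr_ge0.
have ch : continuous h.
  exact: (prim_continuous (primD (primM px px) (primM py py))).
have lh := locint_continuous ch.
have WE a b : a <= b -> W b - W a = - be * itg h a b.
  move=> ab; rewrite pW.2 // -itgZ //; congr itg; apply/funext => t.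
  by rewrite /h; ring.
have hz : forall t, h t = 0.
  apply: itg_eq0 => // a b ab.
  have I0 : 0 <= itg h a b by exact: itg_ge0.
  apply/eqP; rewrite eq_le I0 andbT leNgt; apply/negP => Ipos.
  (* Enlarging [[a, b]] to an interval whose end points lie in the tails does not decrease the
     integral of [h], while the two boundary values of [W] account for at most half of
     [|be| * itg h a b]. *)
  have e0 : 0 < `|be| * itg h a b / 4 by rewrite divr_gt0 // mulr_gt0 // normr_gt0.
  have [M MP] := vW _ e0.
  pose A := Num.min a (- `|M|); pose B := Num.max b `|M|.
  have Aa : A <= a by rewrite /A ge_min lexx.
  have bB : b <= B by rewrite /B le_max lexx.
  have MA : M <= `|A|.
    have : A <= - `|M| by rewrite /A ge_min lexx orbT.
    by have := ler_norm M; have := ler_norm (- A); rewrite normrN; lra.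
  have MB : M <= `|B|.
    have : `|M| <= B by rewrite /B le_max lexx orbT.
    by have := ler_norm M; have := ler_norm B; lra.
  have AB : A <= B by apply: le_trans Aa (le_trans ab bB).
  have E := WE A B AB.
  have sub : itg h a b <= itg h A B by exact: itg_sub.
  have : `|be| * itg h A B <= `|be| * itg h a b / 4 + `|be| * itg h a b / 4.
    have -> : `|be| * itg h A B = `|W B - W A|.
      by rewrite E normrM normrN [`|itg _ _ _|]ger0_norm // itg_ge0.
    by apply: le_trans (ler_normB _ _) _; apply: lerD; exact: MP.
  have := ler_wpM2l (normr_ge0 be) sub.
  by move: e0; lra.
split=> t; have := hz t; have := sqr_ge0 (x t); have := sqr_ge0 (y t); rewrite /h => h1 h2 h3.
  by apply/eqP; rewrite -sqrf_eq0; apply/eqP; lra.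
by apply/eqP; rewrite -sqrf_eq0; apply/eqP; lra.
Qed.

End RealCore.

(** * From the operator to the first-order system *)

Section Reduction.
Context {R : realType}.
Local Notation mu := (@lebesgue_measure R).
Implicit Types (f g u : R -> R[i]) (h k : R -> R) (z w v : R[i]).

Lemma Im_real z : z \is Num.real -> complex.Im z = 0.
Proof.
by case: z => a b; rewrite realE !lecE /= => /orP[] /andP[/eqP].
Qed.

Lemma Re_mul_real w z : complex.Im w = 0 ->
  complex.Re (w * z) = complex.Re w * complex.Re z.
Proof. by case: w z => [a b] [c d] /= ->; rewrite mul0r subr0. Qed.

Lemma Im_mul_real w z : complex.Im w = 0 ->
  complex.Im (w * z) = complex.Re w * complex.Im z.
Proof. by case: w z => [a b] [c d] /= ->; rewrite mul0r addr0. Qed.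

Lemma Re_add z w : complex.Re (z + w) = complex.Re z + complex.Re w.
Proof. by case: z w => [a b] [c d]. Qed.

Lemma Im_add z w : complex.Im (z + w) = complex.Im z + complex.Im w.
Proof. by case: z w => [a b] [c d]. Qed.

Lemma Re_opp z : complex.Re (- z) = - complex.Re z.
Proof. by case: z. Qed.

Lemma Im_opp z : complex.Im (- z) = - complex.Im z.
Proof. by case: z. Qed.

Lemma Re_mul z w : complex.Re (z * w) =
  complex.Re z * complex.Re w - complex.Im z * complex.Im w.
Proof. by case: z w => [a b] [c d]. Qed.

Lemma Im_mul z w : complex.Im (z * w) =
  complex.Re z * complex.Im w + complex.Im z * complex.Re w.
Proof. by case: z w => [a b] [c d]. Qed.

(** Measurability of [k] is a separate hypothesis: the sigma-algebra is the Borel one, so almost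
    everywhere equality alone does not transfer it. *)
Lemma locint_ae h k : locint h -> measurable_fun [set: R] k ->
  ae_eq mu [set: R] h k -> locint k.
Proof.
move=> [mh Ih] mk hk; split=> // a b; have /integrableP[_ Iy] := Ih a b.
apply/integrableP; split; first exact/measurable_EFinP/measurable_funTS.
congr (_ < _)%E: Iy; apply: ae_eq_integral => //.
- by apply/measurable_EFinP/measurable_funTS; exact: measurableT_comp.
- by apply/measurable_EFinP/measurable_funTS; exact: measurableT_comp.
have Fae := ae_filter_ringOfSetsType mu.
by apply: filterS hk => t /= + _ => /(_ I) ->.
Qed.

Lemma integrableT_ae h k : integrableT h -> measurable_fun [set: R] k ->
  ae_eq mu [set: R] h k -> integrableT k.
Proof.
move=> Ih mk hk; have /integrableP[mh Iy] := Ih.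
apply/integrableP; split; first exact/measurable_EFinP.
congr (_ < _)%E: Iy; apply: ae_eq_integral => //.
- by apply/measurable_EFinP; apply: measurableT_comp => //; exact/measurable_EFinP.
- by apply/measurable_EFinP; exact: measurableT_comp.
have Fae := ae_filter_ringOfSetsType mu.
by apply: filterS hk => t /= + _ => /(_ I) ->.
Qed.

(** By periodicity of the approximant, [s (t + T) - s t = d (t + T) - d t], where [d] is the
    approximation error. For [t] in [[- T, T]] both arguments lie in [[- T, 2 T]], the interval of
    Gordon's condition. *)
Lemma singular_gordon_shift sigma tau (s := fun t => complex.Re (sigma t))
    (ta := fun t => complex.Re (tau t)) : singular_gordon sigma tau ->
  forall C M : R, exists T, [/\ 0 < T, M <= T,
    itg (fun t => (s (t + T) - s t) ^+ 2) (- T) T <= expR (- (C * T)) ^+ 2 &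
    itg (fun t => `|ta (t + T) - ta t|) (- T) T <= expR (- (C * T))].
Proof.
move=> [us ut [T [sm [tm [T0 Tcv usm utm lim]]]]] C M.
have [ms ls2 _] := Lp_unif2_Re us; have [lt _] := Lp_unif1_Re ut.
(* The threshold 1/2 gives norms at most [e / 2]. The windows [[- L, L]] and [[0, 2 L]] both lie in
   [[- L, 2 L]], so the squared differences integrate to at most [4 (e / 2) ^ 2 = e ^ 2] and the
   absolute ones to at most [2 (e / 2) = e]. *)
have h2 : (0 : R) < 2^-1 by rewrite invr_gt0.
have N : nbhs (0%E : \bar R) [set y | (y < (2^-1)%:E)%E].
  by apply: open_nbhs_nbhs; split; [exact: open_ereal_lt_ereal|rewrite /= lte_fin].
pose DS m t := sigma t - sm m t; pose DT m t := tau t - tm m t.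
have [m [small MT]] : exists m,
    ((expR (C * T m))%:E * (Lp_norm 2 `[(- T m)%R, (2 * T m)%R] (DS m) +
      Lp_norm 1 `[(- T m)%R, (2 * T m)%R] (DT m)) < (2^-1)%:E)%E /\ M <= T m.
  apply: (@filter_ex _ \oo); apply: filterI; first exact: (lim C _ N).
  by have /cvgryPge := Tcv; apply.
have [usm2 persm] := usm m; have [utm1 pertm] := utm m.
have [msm lsm2 _] := Lp_unif2_Re usm2; have [ltm _] := Lp_unif1_Re utm1.
suff [A B] : itg (fun t => (s (t + T m) - s t) ^+ 2) (- T m) (T m) <= expR (- (C * T m)) ^+ 2 /\
    itg (fun t => `|ta (t + T m) - ta t|) (- T m) (T m) <= expR (- (C * T m)).
  by exists (T m).
move: (T m) (T0 m) persm pertm small => L L0 persm pertm small.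
set e := expR (- (C * L)).
have e0 : 0 < e by exact: expR_gt0.
have eE : e = (expR (C * L))^-1 by rewrite /e expRN.
have {}small : (Lp_norm 2 `[(- L)%R, (2 * L)%R] (DS m) +
      Lp_norm 1 `[(- L)%R, (2 * L)%R] (DT m) <= (e / 2)%:E)%E.
  by apply: ltW; rewrite eE EFinM lte_pdivlMl // expR_gt0.
have e20 : 0 <= e / 2 by rewrite divr_ge0 // ltW.
have n2 : (Lp_norm 2 `[(- L)%R, (2 * L)%R] (DS m) <= (e / 2)%:E)%E.
  by apply: le_trans small; apply: leeDl; exact: Lnorm_ge0.
have n1 : (Lp_norm 1 `[(- L)%R, (2 * L)%R] (DT m) <= (e / 2)%:E)%E.
  by apply: le_trans small; apply: leeDr; exact: Lnorm_ge0.
have cm f g : cmeasurable f -> cmeasurable g -> cmeasurable (fun t => f t - g t).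
  move=> [f1 f2] [g1 g2]; split.
    have -> : (fun t => complex.Re (f t - g t)) = (fun t => complex.Re (f t) - complex.Re (g t)).
      by apply/funext => t; rewrite Re_add Re_opp.
    exact: measurable_funB.
  have -> : (fun t => complex.Im (f t - g t)) = (fun t => complex.Im (f t) - complex.Im (g t)).
    by apply/funext => t; rewrite Im_add Im_opp.
  exact: measurable_funB.
pose d t := s t - complex.Re (sm m t); pose k t := ta t - complex.Re (tm m t).
have md : measurable_fun [set: R] d by exact: measurable_funB.
have ld2 : locint (fun t => d t ^+ 2) by exact: locint_sqrB.
have lk : locint k by exact: locintB.
have dle t : `|d t| <= modulus (sigma t - sm m t).
  by rewrite /d /s -Re_opp -Re_add; exact: Re_le_modulus.
have kle t : `|k t| <= modulus (tau t - tm m t).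
  by rewrite /k /ta -Re_opp -Re_add; exact: Re_le_modulus.
have [_ I2] := Lp_norm2_dom (measurable_itv _) (cm _ _ us.1 usm2.1) md dle e20 n2.
have [_ I1] := Lp_norm1_dom (measurable_itv _) (cm _ _ ut.1 utm1.1) lk.1 kle n1.
have lka := locint_abs lk.
have ld2s : locint (fun t => d (t + L) ^+ 2) by exact: (locint_shift L ld2).
have lkas : locint (fun t => `|k (t + L)|) by exact: (locint_shift L lka).
have LL : L + L = 2 * L by ring.
have sub h : locint h -> (forall t, 0 <= h t) ->
    itg (fun t => h (t + L)) (- L) L + itg h (- L) L <= 2 * itg h (- L) (2 * L).
  move=> lh h0; rewrite itg_shift // addNr LL.
  have := @itg_sub _ h (- L) 0 (2 * L) (2 * L) lh h0.
  have := @itg_sub _ h (- L) (- L) L (2 * L) lh h0.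
  have [a1 a2 a3 a4] : [/\ - L <= 0, 0 <= 2 * L, - L <= L & L <= 2 * L] by split; lra.
  by rewrite !lexx => /(_ isT a3 a4) b1 /(_ a1 a2 isT) b2; lra.
split.
  have sq0 t : 0 <= d t ^+ 2 by exact: sqr_ge0.
  apply: (@le_trans _ _ (itg (fun t => 2 * (d (t + L) ^+ 2 + d t ^+ 2)) (- L) L)).
    apply: itg_le; last first.
    - move=> t _.
      have -> : s (t + L) - s t = d (t + L) - d t by rewrite /d persm; ring.
      by have := sqr_ge0 (d (t + L) + d t); rewrite !expr2; lra.
    - by apply: locintZ; exact: (locintD ld2s ld2).
    apply: locint_sqrB => //; last exact: (locint_shift L ls2).
    by apply: (measurableT_comp ms); apply: measurable_funD => //; exact: measurable_cst.
  rewrite (itgZ _ _ _ (locintD ld2s ld2)) (itgD _ _ ld2s ld2); have := sub _ ld2 sq0.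
  have -> : e ^+ 2 = 4 * (e / 2) ^+ 2 by field.
  by move: I2; rewrite -/(itg _ _ _); lra.
have ab0 t : 0 <= `|k t| by [].
apply: (@le_trans _ _ (itg (fun t => `|k (t + L)| + `|k t|) (- L) L)).
  apply: itg_le; [|exact: (locintD lkas lka)|].
    by apply: locint_abs; apply: locintB => //; exact: locint_shift.
  move=> t _.
  have -> : ta (t + L) - ta t = k (t + L) - k t by rewrite /k pertm; ring.
  exact: ler_normB.
rewrite (itgD _ _ lkas lka); have := sub _ lka ab0.
by move: I1; rewrite -/(itg _ _ _); lra.
Qed.

End Reduction.

Theorem theorem1p1 (R : realType) (sigma tau : R -> R[i])
    (sigma_real : real_valued sigma) (tau_real : real_valued tau)
    (gordon : singular_gordon sigma tau) :
  ~ exists lambda : R[i], schrodinger_eigenvalue sigma tau lambda.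
Proof.
move=> [lambda [u [[[L2u wdu L2Du] [wdQ _] _] u_nz eigen]]].
(* The domain provides weak derivability of [u] and of its quasi-derivative, so [Dw] is a genuine
   weak derivative in both cases. *)
have Wu : weak_derivative u (Dw u) by exact: xgetPex wdu.
pose Q := quasi_derivative sigma u.
have WQ : weak_derivative Q (Dw Q) by exact: xgetPex wdQ.
have [[x y] /= [px py ex ey]] := weak_derivative_prim Wu.
have [[p q] /= [pp pq ep eq]] := weak_derivative_prim WQ.
have [us ut _] := gordon.
have [ms ls2 [S1 S1P]] := Lp_unif2_Re us; have [lt [S2 S2P]] := Lp_unif1_Re ut.
pose s t := complex.Re (sigma t); pose ta t := complex.Re (tau t).
have s_im t : complex.Im (sigma t) = 0 by exact/Im_real/sigma_real.
have ta_im t : complex.Im (tau t) = 0 by exact/Im_real/tau_real.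
have Fae := ae_filter_ringOfSetsType (@lebesgue_measure R).
have S0 : 0 <= S1 by apply: le_trans (S1P 0); apply: itg_ge0 => t; exact: sqr_ge0.
have S20 : 0 <= S2 by apply: le_trans (S2P 0); exact: itg_ge0.
have sS t : itg (fun r => s r ^+ 2) t (t + 1) <= S1 + S2.
  by apply: le_trans (S1P t) _; rewrite lerDl.
have taS t : itg (fun r => `|ta r|) t (t + 1) <= S1 + S2.
  by apply: le_trans (S2P t) _; rewrite lerDr.
have [mx my] := (prim_measurable px, prim_measurable py).
have [mp mq] := (prim_measurable pp, prim_measurable pq).
have mta : measurable_fun [set: R] ta := lt.1.
have exy : {ae @lebesgue_measure R, forall t, complex.Re (u t) = x t /\ complex.Im (u t) = y t}.
  by apply: filterS2 ex ey => t h1 h2; split; [exact: h1|exact: h2].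
(* The definition of the quasi-derivative, solved for [Dw u], is the first equation of the system;
   as [sigma] is real, it splits into components. *)
have eDx : ae_eq (@lebesgue_measure R) [set: R] (fun t => complex.Re (Dw u t))
    (fun t => s t * x t + p t).
  apply: filterS2 ex ep => t h1 h2 _; rewrite -(h1 I) -(h2 I) /Q /quasi_derivative.
  by rewrite Re_add Re_opp Re_mul_real // /s; ring.
have eDy : ae_eq (@lebesgue_measure R) [set: R] (fun t => complex.Im (Dw u t))
    (fun t => s t * y t + q t).
  apply: filterS2 ey eq => t h1 h2 _; rewrite -(h1 I) -(h2 I) /Q /quasi_derivative.
  by rewrite Im_add Im_opp Im_mul_real // /s; ring.
pose al := complex.Re lambda; pose be := complex.Im lambda.
(* The eigenvalue equation, solved for [Dw Q], is the second equation; the components of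
   [lambda * u] couple [x] and [y]. *)
have eDp : ae_eq (@lebesgue_measure R) [set: R] (fun t => complex.Re (Dw Q t))
    (fun t => - s t * (s t * x t + p t) + ta t * x t - (al * x t - be * y t)).
  apply: filterS3 eDx eigen exy => t h1 h2 [h3 h4] _.
  have := congr1 (@complex.Re R) (h2 I).
  rewrite /schrodinger_expr -/Q !Re_add !Re_opp (Re_mul_real _ (s_im t)) (Re_mul_real _ (ta_im t)) Re_mul.
  by rewrite -(h1 I) -h3 -h4 /s /ta /al /be => E; lra.
have eDq : ae_eq (@lebesgue_measure R) [set: R] (fun t => complex.Im (Dw Q t))
    (fun t => - s t * (s t * y t + q t) + ta t * y t - (al * y t + be * x t)).
  apply: filterS3 eDy eigen exy => t h1 h2 [h3 h4] _.
  have := congr1 (@complex.Im R) (h2 I).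
  rewrite /schrodinger_expr -/Q !Im_add !Im_opp (Im_mul_real _ (s_im t)) (Im_mul_real _ (ta_im t)) Im_mul.
  by rewrite -(h1 I) -h3 -h4 /s /ta /al /be => E; lra.
have mwx : measurable_fun [set: R] (fun t => s t * x t + p t).
  by apply: measurable_funD => //; exact: measurable_funM.
have mwy : measurable_fun [set: R] (fun t => s t * y t + q t).
  by apply: measurable_funD => //; exact: measurable_funM.
(* The weak derivatives are replaced by the right-hand sides in terms of the continuous
   representatives, which closes the system in [x], [y], [p], [q]. *)
have px' := prim_ae px (locint_ae px.1 mwx eDx) eDx.
have py' := prim_ae py (locint_ae py.1 mwy eDy) eDy.
have mns : measurable_fun [set: R] (fun t => - s t) by exact: measurable_funN.
have mqx : measurable_fun [set: R]
    (fun t => - s t * (s t * x t + p t) + ta t * x t - (al * x t - be * y t)).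
  apply: measurable_funB; last by apply: measurable_funB; exact: measurable_funM.
  by apply: measurable_funD; exact: measurable_funM.
have mqy : measurable_fun [set: R]
    (fun t => - s t * (s t * y t + q t) + ta t * y t - (al * y t + be * x t)).
  apply: measurable_funB; last by apply: measurable_funD; exact: measurable_funM.
  by apply: measurable_funD; exact: measurable_funM.
have pp' := prim_ae pp (locint_ae pp.1 mqx eDp) eDp.
have pq' := prim_ae pq (locint_ae pq.1 mqy eDq) eDq.
have sq h k : ae_eq (@lebesgue_measure R) [set: R] h k ->
    ae_eq (@lebesgue_measure R) [set: R] (fun t => h t ^+ 2 : R) (fun t => k t ^+ 2).
  by move=> hk; apply: filterS hk => t E /E ->.
have [[muR muI] _] := L2u; have [[mDR mDI] _] := L2Du.
have Ix : integrableT (fun t => x t ^+ 2).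
  exact: integrableT_ae (Lp2_integrable L2u muR (fun t => Re_le_modulus _)) (measurable_funX 2 mx) (sq _ _ ex).
have Iy : integrableT (fun t => y t ^+ 2).
  exact: integrableT_ae (Lp2_integrable L2u muI (fun t => Im_le_modulus _)) (measurable_funX 2 my) (sq _ _ ey).
have Iwx : integrableT (fun t => (s t * x t + p t) ^+ 2).
  exact: integrableT_ae (Lp2_integrable L2Du mDR (fun t => Re_le_modulus _)) (measurable_funX 2 mwx) (sq _ _ eDx).
have Iwy : integrableT (fun t => (s t * y t + q t) ^+ 2).
  exact: integrableT_ae (Lp2_integrable L2Du mDI (fun t => Im_le_modulus _)) (measurable_funX 2 mwy) (sq _ _ eDy).
have [x0 y0] := complex_trivial ms ls2 lt sS taS (singular_gordon_shift gordon)
  px' py' pp' pq' Ix Iy Iwx Iwy.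
apply: u_nz; apply: filterS2 ex ey => t h1 h2 _.
by have := h1 I; have := h2 I; rewrite x0 y0; case: (u t) => a b /= -> ->.
Qed.
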